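(* Let $V$ be an optimal prefix-free machine and let $T>0$ be real. Define $\overline{\Theta}_V(T)=\sum_{s\in\{0,1\}^*,\,H_V(s)<T|s|}2^{-|s|}$. Then: (i) if $T$ is left-computable and $0<T\le 1$, then $\overline{\Theta}_V(T)$ is a left-computable real which is weakly Chaitin $T$-random; (ii) if $T$ is computable and $0<T<1$, then $\overline{\Theta}_V(T)$ is strictly $T$-compressible; (iii) if $1<T$, then $\overline{\Theta}_V(T)$ diverges to $\infty$.
   Context: $\{0,1\}^*$ is the set of finite binary strings; $|s|$ is the length of $s$. A prefix-free machine is a partial recursive function $C:\{0,1\}^*\to\{0,1\}^*$ whose domain is prefix-free. $H_C(s)=\min\{|p| : C(p)=s\}$ (possibly $\infty$). A prefix-free machine $U$ is optimal if for every prefix-free machine $C$ there is $d\in\mathbb{N}$ such that for every $p\in\mathrm{Dom}\,C$ there is $q\in\mathrm{Dom}\,U$ with $U(q)=C(p)$ and $|q|\le|p|+d$. A particular optimal prefix-free machine $U$ is fixed and $H(s):=H_U(s)$. For a real $\alpha$ and $n\ge1$, $\alpha\restriction n$ denotes the first $n$ bits of the base-two expansion of $\alpha-\lfloor\alpha\rfloor$ (the expansion with infinitely many zeros). A real $\alpha$ is computable if there is a total recursive $f:\mathbb{N}^+\to\mathbb{Q}$ with $|\alpha-f(n)|<1/n$ for all $n$; right-computable if there is a total recursive $f:\mathbb{N}^+\to\mathbb{Q}$ with $\alpha\le f(n)$ for all $n$ and $f(n)\to\alpha$; left-computable if $-\alpha$ is right-computable. For $T\in(0,1]$, $\alpha$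 is weakly Chaitin $T$-random if there is $c\in\mathbb{N}$ with $Tn-c\le H(\alpha\restriction n)$ for all $n\in\mathbb{N}^+$; $\alpha$ is strictly $T$-compressible if there is $d\in\mathbb{N}$ with $H(\alpha\restriction n)\le Tn+d$ for all $n\in\mathbb{N}^+$. *)

(* Defs.v *)
From HB Require Import structures.
From mathcomp Require Import all_boot all_order all_algebra.
From mathcomp Require Import all_classical all_reals all_analysis.
Set Implicit Arguments. Unset Strict Implicit. Unset Printing Implicit Defensive.
Import Order.TTheory GRing.Theory Num.Theory.
Import numFieldNormedType.Exports.
Local Open Scope classical_set_scope.
Local Open Scope ring_scope.

(* Cantor pairing and its inverse (enumeration of nat * nat by diagonals). *)
Definition npair (x y : nat) : nat := (((x + y) * (x + y).+1) %/ 2 + y)%N.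

Fixpoint unpair (n : nat) : nat * nat :=
  match n with
  | 0 => (0, 0)
  | k.+1 => let: (x, y) := unpair k in
            if x is x'.+1 then (x', y.+1) else (y.+1, 0)
  end.

Inductive mrcode : Type :=
| CZero
| CSucc
| CId
| CFst
| CSnd
| CPair of mrcode & mrcode
| CComp of mrcode & mrcode
| CPrec of mrcode & mrcode
| CMin of mrcode.

Inductive eval : mrcode -> nat -> nat -> Prop :=
| eZero x : eval CZero x 0
| eSucc x : eval CSucc x x.+1
| eId x : eval CId x x
| eFst x : eval CFst x (unpair x).1
| eSnd x : eval CSnd x (unpair x).2
| ePair f g x a b : eval f x a -> eval g x b -> eval (CPair f g) x (npair a b)
| eComp f g x y z : eval g x y -> eval f y z -> eval (CComp f g) x z
| ePrec0 f g x y : eval f x y -> eval (CPrec f g) (npair x 0) y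
| ePrecS f g x n y z : eval (CPrec f g) (npair x n) y ->
    eval g (npair x (npair n y)) z -> eval (CPrec f g) (npair x n.+1) z
| eMin f x n : eval f (npair x n) 0 ->
    (forall m, (m < n)%N -> exists k, eval f (npair x m) k.+1) ->
    eval (CMin f) x n.

(* bijective encoding of binary strings {0,1}^* as natural numbers *)
Fixpoint enc (s : bitseq) : nat :=
  match s with
  | [::] => 0
  | b :: s' => ((enc s').*2 + 1 + b)%N
  end.

(* surjective (recursive) decoding of natural numbers as rationals *)
Definition zdec (a : nat) : int :=
  if odd a then - ((a.+1)./2)%:Z else (a./2)%:Z.
Definition qdec (m : nat) : rat :=
  let: (a, b) := unpair m in (zdec a)%:~R / (b.+1)%:R.

Definition total_recursive_posQ (f : nat -> rat) : Prop :=
  exists c : mrcode, forall n : nat, (0 < n)%N ->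
    exists m : nat, eval c n m /\ qdec m = f n.

Definition runs (c : mrcode) (p s : bitseq) : Prop := eval c (enc p) (enc s).

Definition Dom (c : mrcode) : set bitseq := [set p | exists s, runs c p s].

Definition prefix_free_machine (c : mrcode) : Prop :=
  forall p q, Dom c p -> Dom c q -> prefix p q -> p = q.

Definition optimal (U : mrcode) : Prop :=
  prefix_free_machine U /\
  forall C : mrcode, prefix_free_machine C ->
    exists d : nat, forall p s, runs C p s ->
      exists q, runs U q s /\ (size q <= size p + d)%N.

(* H_C(s) = min { |p| : C(p) = s }, +oo if there is no such p *)
Definition Hc {R : realType} (C : mrcode) (s : bitseq) : \bar R :=
  ereal_inf [set ((size p)%:R)%:E | p in [set p | runs C p s]].

(* the k-th bit (k >= 1) of the binary expansion of x - floor x,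
   the expansion with infinitely many zeros *)
Definition bit {R : realType} (x : R) (k : nat) : bool :=
  odd `|Num.floor ((2:R) ^+ k * (x - (Num.floor x)%:~R))|%N.

Definition restr {R : realType} (x : R) (n : nat) : bitseq :=
  [seq bit x i.+1 | i <- iota 0 n].

Definition computable_real {R : realType} (a : R) : Prop :=
  exists f, total_recursive_posQ f /\
    forall n : nat, (0 < n)%N -> `|a - ratr (f n)| < n%:R^-1.

Definition right_computable {R : realType} (a : R) : Prop :=
  exists f, total_recursive_posQ f /\
    (forall n : nat, (0 < n)%N -> a <= ratr (f n)) /\
    ((fun n : nat => (ratr (f n) : R)) @ \oo --> a).

Definition left_computable {R : realType} (a : R) : Prop :=
  right_computable (- a).

Definition weakly_chaitin_random {R : realType} (U : mrcode) (T a : R) : Prop :=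
  exists c : nat, forall n : nat, (0 < n)%N ->
    ((T * n%:R - c%:R)%:E <= Hc U (restr a n))%E.

Definition strictly_compressible {R : realType} (U : mrcode) (T a : R) : Prop :=
  exists d : nat, forall n : nat, (0 < n)%N ->
    (Hc U (restr a n) <= (T * n%:R + d%:R)%:E)%E.

Definition ThetaBar {R : realType} (V : mrcode) (T : R) : \bar R :=
  \esum_(s in [set s : bitseq | (Hc V s < (T * (size s)%:R)%:E)%E])
     (((2:R) ^- size s)%:E).

(* Main.v *)
Require Import Defs.
From HB Require Import structures.
From mathcomp Require Import all_boot all_order all_algebra.
From mathcomp Require Import all_classical all_reals all_analysis.
From mathcomp Require Import zify ring lra.
Import Order.TTheory GRing.Theory Num.Theory.
Local Open Scope ring_scope.

(* Write Theta for the sum; the strings s with H_V(s) < T|s| ("short" strings)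
   form a recursively enumerable set, so Theta is the limit of an increasing
   recursive sequence theta_t of dyadic rationals, and it converges for T <= 1
   by Kraft's inequality.

   (i) The first n bits of Theta yield a stage t with Theta - theta_t < 2 * 2^-n,
   hence all short strings of length n - 1, hence a string of length n - 1 which
   is not short; by optimality of V its complexity T(n - 1) is at most
   H(Theta|n) + O(1).

   (ii) Every string enumerated makes theta_t cross boundaries of cells of length
   2^-n; up to one crossing, a string of length m is responsible for
   min(1, 2^(n - m)) of them.  With T < 1 the sum over n of 2^(-Tn) min(1, 2^(n - m))
   is O(2^(-Tm)), and the sum over all short strings of 2^(-T|s|) is at most 1.  So
   the requests "Tn + O(1) bits for the n-th cell reached" satisfy Kraft's
   inequality and are served by a Kraft-Chaitin machine.

   (iii) If 1/L is small against T - 1, all long strings of length divisible by L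
   are short, since 1^q 0 s with q = |s|/L is a prefix-free code. *)

Set Implicit Arguments.
Unset Strict Implicit.
Local Open Scope nat_scope.
Local Notation eval := Defs.eval.

(** * Recursive functions *)

Lemma npairS0 x : npair x.+1 0 = (npair 0 x).+1.
Proof. by rewrite /npair; have := odd_double_half x; nia. Qed.

Lemma npairxS x y : npair x y.+1 = (npair x.+1 y).+1.
Proof. by rewrite /npair addnS addSn addnS. Qed.

Lemma npairK x y : unpair (npair x y) = (x, y).
Proof.
(* Outer induction on the diagonal [x + y], inner induction on the position [y] in it, in the order
   in which [unpair] walks. *)
have [s] := ubnP (x + y); elim: s x y => // s IHs x y.
elim: y x => [|y IHy] x.
  case: x => [//|x] lts.
  rewrite npairS0 /= IHs //; lia.
by move=> lts; rewrite npairxS /= IHy // addSnnS.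
Qed.

Lemma unpairK z : npair (unpair z).1 (unpair z).2 = z.
Proof.
elim: z => // z /=; case: (unpair z) => [[|x] y] /= <-.
  by rewrite npairS0.
by rewrite npairxS.
Qed.

Definition rec (f : nat -> nat) := exists c, forall x, eval c x (f x).
(** Predicates are handled through their 0/1 characteristic functions, several arguments through
    [unpair]; triples are nested to the right, as in [ePrecS]. *)
Notation recb p := (rec (fun x => nat_of_bool (p x))).
Notation rec2 f := (rec (fun z => f (unpair z).1 (unpair z).2)).
Notation rec3 f :=
  (rec (fun z => f (unpair z).1 (unpair (unpair z).2).1 (unpair (unpair z).2).2)).

Lemma rec_eq (f g : nat -> nat) : f =1 g -> rec f -> rec g.
Proof. by move=> /funext->. Qed.

Lemma rec_id : rec (fun x => x).
Proof. by exists CId; constructor. Qed.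

Lemma rec_const n : rec (fun=> n).
Proof.
elim: n => [|n [c cP]]; first by exists CZero; constructor.
by exists (CComp CSucc c) => x; apply: eComp (cP x) _; constructor.
Qed.

Lemma rec_comp g f : rec g -> rec f -> rec (fun x => g (f x)).
Proof.
move=> [c cP] [d dP]; exists (CComp c d) => x.
exact: eComp (dP x) (cP _).
Qed.

Lemma rec_succ f : rec f -> rec (fun x => (f x).+1).
Proof. by apply: rec_comp; exists CSucc; constructor. Qed.

Lemma rec_fst f : rec f -> rec (fun x => (unpair (f x)).1).
Proof. by apply: (rec_comp (g := fun x => (unpair x).1)); exists CFst; constructor. Qed.

Lemma rec_snd f : rec f -> rec (fun x => (unpair (f x)).2).
Proof. by apply: (rec_comp (g := fun x => (unpair x).2)); exists CSnd; constructor. Qed.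

Lemma rec_npair f g : rec f -> rec g -> rec (fun x => npair (f x) (g x)).
Proof. by move=> [c cP] [d dP]; exists (CPair c d); constructor. Qed.

Lemma rec2_app (f : nat -> nat -> nat) g h :
  rec2 f -> rec g -> rec h -> rec (fun x => f (g x) (h x)).
Proof.
move=> rf rg rh; have := rec_comp rf (rec_npair rg rh).
by apply: rec_eq => x; rewrite npairK.
Qed.

(** Primitive recursion in the form of [iteri]; arithmetic, bounded sums and bounded search are
    derived from it. *)
Lemma rec_iteri (h : nat -> nat -> nat -> nat) f g :
  rec f -> rec g -> rec3 h -> rec (fun x => iteri (f x) (h x) (g x)).
Proof.
move=> rf [c cP] [d dP].
suff r2 : rec2 (fun x n => iteri n (h x) (g x)).
  exact: (rec2_app (f := fun x n => iteri n (h x) (g x)) r2 rec_id rf).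
exists (CPrec c d) => z; rewrite -{1}[z]unpairK.
elim: (unpair z).2 => [|n IHn]; first exact: ePrec0.
by apply: (ePrecS IHn); have := dP (npair (unpair z).1 (npair n (iteri n (h (unpair z).1)
  (g (unpair z).1)))); rewrite !npairK.
Qed.

Lemma rec_add f g : rec f -> rec g -> rec (fun x => f x + g x).
Proof.
move=> rf rg; have: rec (fun x => iteri (g x) (fun _ y => y.+1) (f x)).
  by apply: rec_iteri => //; apply/rec_succ/rec_snd/rec_snd/rec_id.
by apply: rec_eq => x; elim: (g x) => [|n /= ->]; rewrite ?addn0 ?addnS.
Qed.

Lemma rec_pred f : rec f -> rec (fun x => (f x).-1).
Proof.
move=> rf; have: rec (fun x => iteri (f x) (fun n _ => n) 0).
  by apply: rec_iteri => //; [exact: rec_const|apply/rec_fst/rec_snd/rec_id].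
by apply: rec_eq => x; case: (f x).
Qed.

Lemma rec_sub f g : rec f -> rec g -> rec (fun x => f x - g x).
Proof.
move=> rf rg; have: rec (fun x => iteri (g x) (fun _ y => y.-1) (f x)).
  by apply: rec_iteri => //; apply/rec_pred/rec_snd/rec_snd/rec_id.
by apply: rec_eq => x; elim: (g x) => [|n /= ->]; rewrite ?subn0 ?subnS.
Qed.

Lemma rec_sum (F : nat -> nat -> nat) f :
  rec f -> rec2 F -> rec (fun x => \sum_(i < f x) F x i).
Proof.
move=> rf rF; have: rec (fun x => iteri (f x) (fun n y => y + F x n) 0).
  apply: (rec_iteri (h := fun x n y => y + F x n)) => //; first exact: rec_const.
  apply: rec_add; first exact/rec_snd/rec_snd/rec_id.
  by apply: rec2_app rF _ _; [apply/rec_fst/rec_id|apply/rec_fst/rec_snd/rec_id].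
apply: rec_eq => x; elim: (f x) => [|n /= ->]; rewrite ?big_ord0 //.
by rewrite big_ord_recr.
Qed.

Lemma rec_mul f g : rec f -> rec g -> rec (fun x => f x * g x).
Proof.
move=> rf rg; have: rec (fun x => \sum_(i < f x) g x).
  apply: (rec_sum (F := fun x _ => g x)) => //; apply: rec_comp rg _; exact/rec_fst/rec_id.
by apply: rec_eq => x; rewrite sum_nat_const card_ord.
Qed.

Lemma rec_exp f g : rec f -> rec g -> rec (fun x => f x ^ g x).
Proof.
move=> rf rg; have: rec (fun x => iteri (g x) (fun _ y => f x * y) 1).
  apply: (rec_iteri (h := fun x _ y => f x * y)) => //; first exact: rec_const.
  apply: rec_mul; last exact/rec_snd/rec_snd/rec_id.
  apply: rec_comp rf _; exact/rec_fst/rec_id.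
by apply: rec_eq => x; elim: (g x) => [|n /= ->]; rewrite ?expn0 ?expnS.
Qed.

Lemma rec_neg (p : nat -> bool) : recb p -> recb (fun x => ~~ p x).
Proof.
move=> rp; have := rec_sub (rec_const 1) rp.
by apply: rec_eq => x; case: (p x).
Qed.

Lemma rec_and (p q : nat -> bool) : recb p -> recb q -> recb (fun x => p x && q x).
Proof.
move=> rp rq; have := rec_mul rp rq.
by apply: rec_eq => x; case: (p x); case: (q x).
Qed.

Lemma rec_leq f g : rec f -> rec g -> recb (fun x => f x <= g x).
Proof.
move=> rf rg; have := rec_sub (rec_const 1) (rec_sub rf rg).
by apply: rec_eq => x; rewrite /leq; case: (f x - g x).
Qed.

Lemma rec_eqn f g : rec f -> rec g -> recb (fun x => f x == g x).
Proof.
move=> rf rg; have := rec_and (rec_leq rf rg) (rec_leq rg rf).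
by apply: rec_eq => x; rewrite eqn_leq.
Qed.

Lemma rec_if (p : nat -> bool) f g : recb p -> rec f -> rec g ->
  rec (fun x => if p x then f x else g x).
Proof.
move=> rp rf rg.
have := rec_add (rec_mul rp rf) (rec_mul (rec_neg rp) rg).
by apply: rec_eq => x; case: (p x); rewrite ?mul1n ?mul0n ?addn0.
Qed.

Lemma rec_divn f g : rec f -> rec g -> rec (fun x => f x %/ g x).
Proof.
move=> rf rg.
(* The quotient counts the positive multiples of [g x] up to [f x]. For divisor 0 that count would
   be [f x], whereas [%/] gives 0. *)
have: rec (fun x => if g x == 0 then 0 else \sum_(i < f x) (i.+1 * g x <= f x)).
  apply: rec_if; [exact: rec_eqn rg (rec_const 0)|exact: rec_const|].
  apply: (rec_sum (F := fun x i => i.+1 * g x <= f x)) => //; apply: rec_leq.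
    exact: rec_mul (rec_succ (rec_snd rec_id)) (rec_comp rg (rec_fst rec_id)).
  exact: rec_comp rf (rec_fst rec_id).
apply: rec_eq => x; case: eqP => [->|/eqP]; first by rewrite divn0.
rewrite -lt0n => g0.
under eq_bigr do rewrite -leq_divRL //.
have le : f x %/ g x <= f x by exact: leq_div.
rewrite -(big_mkord xpredT (fun i => (i < f x %/ g x : nat))) (big_cat_nat (leq0n _) le) /=.
rewrite [X in _ + X]big1_seq => [|i]; last first.
  by rewrite mem_index_iota leqNgt => /andP[_ /andP[/negbTE->]].
rewrite addn0 (eq_big_nat _ _ (F2 := fun=> 1)) => [|i /andP[_ ->]] //.
by rewrite sum_nat_const_nat subn0 muln1.
Qed.

Lemma rec_modn f g : rec f -> rec g -> rec (fun x => f x %% g x).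
Proof.
move=> rf rg.
have := rec_sub rf (rec_mul (rec_divn rf rg) rg).
by apply: rec_eq => x; rewrite {1}(divn_eq (f x) (g x)) addKn.
Qed.

Lemma rec_odd f : rec f -> recb (fun x => odd (f x)).
Proof.
move=> rf; have := rec_modn rf (rec_const 2).
by apply: rec_eq => x; rewrite modn2.
Qed.

Lemma rec_find (P : nat -> nat -> bool) f : rec f -> rec2 P ->
  rec (fun x => find (P x) (iota 0 (f x))).
Proof.
move=> rf rP.
(* The accumulator equals the current index [n] as long as nothing has been found and stays frozen
   below it afterwards. *)
have: rec (fun x => iteri (f x) (fun n y => if y == n then (if P x n then n else n.+1) else y) 0).
  apply: (rec_iteri (h := fun x n y => if y == n then if P x n then n else n.+1 else y)) => //.
    exact: rec_const.
  have r1 : rec (fun z => (unpair (unpair z).2).1) by apply/rec_fst/rec_snd/rec_id.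
  have r2 : rec (fun z => (unpair (unpair z).2).2) by apply/rec_snd/rec_snd/rec_id.
  apply: rec_if => //; first exact: rec_eqn.
  apply: rec_if => //; last exact: rec_succ.
  by apply: (rec2_app (f := fun x n => P x n : nat)) => //; exact/rec_fst/rec_id.
apply: rec_eq => x; elim: (f x) => // n IHn.
rewrite -[in RHS]addn1 iotaD find_cat [LHS]/= IHn has_find size_iota add0n /=.
case: ltngtP => [//||_]; last by case: (P x n); rewrite ?addn0 ?addn1.
by rewrite ltnNge -[leqRHS](size_iota 0) find_size.
Qed.

Lemma rec_has (P : nat -> nat -> bool) f : rec f -> rec2 P ->
  recb (fun x => has (P x) (iota 0 (f x))).
Proof.
move=> rf rP; have := rec_leq (rec_succ (rec_find rf rP)) rf.
by apply: rec_eq => x; rewrite has_find size_iota.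
Qed.

(** Peels off the outermost operation of the body; parameters are closed by [rec] hypotheses from
    the context. *)
Ltac rec_step := cbn beta; first [exact: rec_id | exact: rec_const | lazymatch goal with
  | |- rec (fun x => S (@?f x)) => apply: (rec_succ (f := f))
  | |- rec (fun x => fst (unpair (@?f x))) => apply: (rec_fst (f := f))
  | |- rec (fun x => snd (unpair (@?f x))) => apply: (rec_snd (f := f))
  | |- rec (fun x => npair (@?f x) (@?g x)) => apply: (rec_npair (f := f) (g := g))
  | |- rec (fun x => addn (@?f x) (@?g x)) => apply: (rec_add (f := f) (g := g))
  | |- rec (fun x => subn (@?f x) (@?g x)) => apply: (rec_sub (f := f) (g := g))
  | |- rec (fun x => muln (@?f x) (@?g x)) => apply: (rec_mul (f := f) (g := g))
  | |- rec (fun x => expn (@?f x) (@?g x)) => apply: (rec_exp (f := f) (g := g))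
  | |- rec (fun x => predn (@?f x)) => apply: (rec_pred (f := f))
  | |- rec (fun x => divn (@?f x) (@?g x)) => apply: (rec_divn (f := f) (g := g))
  | |- rec (fun x => modn (@?f x) (@?g x)) => apply: (rec_modn (f := f) (g := g))
  | |- rec (fun x => find (@?P x) (iota 0 (@?f x))) => apply: (rec_find (P := P) (f := f))
  | |- rec (fun x => iteri (@?f x) (@?h x) (@?g x)) =>
      apply: (rec_iteri (h := h) (f := f) (g := g))
  | |- rec (fun x => nat_of_bool (leq (@?f x) (@?g x))) => apply: (rec_leq (f := f) (g := g))
  | |- rec (fun x => nat_of_bool (eq_op (@?f x) (@?g x))) => apply: (rec_eqn (f := f) (g := g))
  | |- rec (fun x => nat_of_bool (odd (@?f x))) => apply: (rec_odd (f := f))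
  | |- rec (fun x => nat_of_bool (negb (@?p x))) => apply: (rec_neg (p := p))
  | |- rec (fun x => nat_of_bool (andb (@?p x) (@?q x))) => apply: (rec_and (p := p) (q := q))
  | |- rec (fun x => nat_of_bool (has (@?P x) (iota 0 (@?f x)))) =>
      apply: (rec_has (P := P) (f := f))
  | H : rec ?f |- rec ?f => exact: H
  | H : rec ?f |- rec (fun x => ?f (@?g x)) => apply: (rec_comp (g := f) (f := g) H)
  | H : rec (fun z => ?f (unpair z).1 (unpair z).2) |- rec (fun x => ?f (@?g x) (@?h x)) =>
      apply: (rec2_app (f := f) (g := g) (h := h) H)
  | |- _ => match goal with
    | |- rec (fun x => nat_of_bool (?p (@?g x))) =>
        refine (rec_comp (g := fun z => nat_of_bool (p z)) (f := g) _ _); [assumption|]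
    | |- rec (fun x => nat_of_bool (?p (@?g x) (@?h x))) =>
        refine (rec2_app (f := fun a b => nat_of_bool (p a b)) (g := g) (h := h) _ _ _);
        [assumption| |]
    | |- _ => apply: rec_if
    end
  end].
Ltac rec_tac := repeat rec_step.


(** * Time-bounded evaluation of codes *)

Lemma eval_prec0 f g x y : eval (CPrec f g) (npair x 0) y -> eval f x y.
Proof.
move=> H; inversion H; match goal with E : npair _ _ = npair _ _ |- _ =>
  by move/(congr1 unpair): E; rewrite !npairK => -[] // <- end.
Qed.

Lemma eval_precS f g x n y : eval (CPrec f g) (npair x n.+1) y ->
  exists2 a, eval (CPrec f g) (npair x n) a & eval g (npair x (npair n a)) y.
Proof.
move=> H; inversion H as [| | | | | | | |? ? x' m a|];
  match goal with E : npair _ _ = npair _ _ |- _ =>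
    move/(congr1 unpair): E; rewrite !npairK => -[] // ? ?; subst end.
by exists a.
Qed.

(* The value 0 stands for "not yet halted". The evaluator is built by induction on
   the code [c], so no universal machine is needed. *)
Lemma rec_eval c : exists e : nat -> nat -> nat,
  [/\ rec2 e, forall x t y, e x t = y.+1 -> eval c x y &
      forall x y, eval c x y -> exists t0, forall t, t0 <= t -> e x t = y.+1].
Proof.
elim: c => [||||| f [ef [rf sf kf]] g [eg [rg sg kg]]
  | f [ef [rf sf kf]] g [eg [rg sg kg]] | f [ef [rf sf kf]] g [eg [rg sg kg]]
  | f [ef [rf sf kf]]].
- exists (fun _ _ => 1); split; first by rec_tac.
    by move=> x t y [<-]; constructor.
  by move=> x y H; inversion H; subst; exists 0.
- exists (fun x _ => x.+2); split; first by rec_tac.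
    by move=> x t y [<-]; constructor.
  by move=> x y H; inversion H; subst; exists 0.
- exists (fun x _ => x.+1); split; first by rec_tac.
    by move=> x t y [<-]; constructor.
  by move=> x y H; inversion H; subst; exists 0.
- exists (fun x _ => (unpair x).1.+1); split; first by rec_tac.
    by move=> x t y [<-]; constructor.
  by move=> x y H; inversion H; subst; exists 0.
- exists (fun x _ => (unpair x).2.+1); split; first by rec_tac.
    by move=> x t y [<-]; constructor.
  by move=> x y H; inversion H; subst; exists 0.
- exists (fun x t => if (0 < ef x t) && (0 < eg x t)
    then (npair (ef x t).-1 (eg x t).-1).+1 else 0); split; first by rec_tac.
    move=> x t y; case E1: (ef x t) => [//|a]; case E2: (eg x t) => [//|b] /= [<-].
    by apply: ePair; [exact: sf E1|exact: sg E2].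
  move=> x y H; inversion H as [| | | | |? ? ? a b fa gb| | | |]; subst.
  have [t1 h1] := kf _ _ fa; have [t2 h2] := kg _ _ gb.
  by exists (maxn t1 t2) => t; rewrite geq_max => /andP[/h1-> /h2->].
- exists (fun x t => if 0 < eg x t then ef (eg x t).-1 t else 0).
  split; first by rec_tac.
    move=> x t y; case E: (eg x t) => [//|b] /= E2.
    exact: eComp (sg _ _ _ E) (sf _ _ _ E2).
  move=> x y H; inversion H as [| | | | | |? ? ? z ? gz fy| | |]; subst.
  have [t1 h1] := kg _ _ gz; have [t2 h2] := kf _ _ fy.
  by exists (maxn t1 t2) => t; rewrite geq_max => /andP[/h1-> /h2].
- pose e z t := iteri (unpair z).2 (fun m acc => if 0 < acc then
    eg (npair (unpair z).1 (npair m acc.-1)) t else 0) (ef (unpair z).1 t).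
  exists e; split.
  + by rewrite /e; rec_tac.
  + move=> z t y; rewrite /e -[X in eval _ X]unpairK.
    elim: (unpair z).2 y => [|n IHn] y /=.
      by move/sf/ePrec0.
    case E: (iteri _ _ _) => [//|a] /= /sg; apply: ePrecS; exact: IHn.
  + move=> z y; rewrite /e -[X in eval _ X]unpairK.
    elim: (unpair z).2 y => [|n IHn] y H.
      by have := eval_prec0 H; apply: kf.
    have [a Ha Hg] := eval_precS H.
    have [t1 h1] := IHn _ Ha; have [t2 h2] := kg _ _ Hg.
    by exists (maxn t1 t2) => t; rewrite geq_max => /andP[/h1 /= -> /h2].
(* An evaluator value of at most 1 means: not yet halted, or halted with 0. So [n x t] is the first
   argument not yet known to have a positive value, and it is accepted only once its value is known
   to be 0. *)
- pose n x t := find (fun n => ef (npair x n) t <= 1) (iota 0 t).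
  exists (fun x t => if ef (npair x (n x t)) t == 1 then (n x t).+1 else 0); split.
  + by rewrite /n; rec_tac.
  + move=> x t y; case: eqP => // /sf E [<-]; apply: eMin => // m lt.
    have := before_find 0 lt.
    have ltt : m < t by rewrite (leq_trans lt) // -[leqRHS](size_iota 0) find_size.
    rewrite nth_iota //= add0n.
    case E2: (ef _ _) => [//|[//|a]] _; exists a; exact: sf E2.
  + move=> x y H; inversion H as [| | | | | | | | |? ? ? H0 Hlt]; subst.
    have [t0 h0] := kf _ _ H0.
    (* A single time bound serves all the finitely many arguments below [y]. *)
    have [t1 h1] : exists t1, forall t, t1 <= t -> forall m, m < y -> 1 < ef (npair x m) t.
      elim: {H0 h0 H} y Hlt => [|y IHy] Hlt; first by exists 0.
      have [m lt|t1 h1] := IHy; first by apply: Hlt; rewrite (ltn_trans lt).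
      have [k /kf[t2 h2]] := Hlt y (ltnSn _).
      exists (maxn t1 t2) => t; rewrite geq_max => /andP[/h1 h /h2 h'] m.
      by rewrite ltnS leq_eqVlt => /predU1P[->|/h//]; rewrite h'.
    exists (maxn (maxn t0 t1) y.+1) => t; rewrite !geq_max => /andP[/andP[/h0 e0 /h1 {}h1] lt].
    suff -> : n x t = y by rewrite e0.
    have -> : n x t = find (fun n => ef (npair x n) t <= 1) (iota 0 y ++ y :: iota y.+1 (t - y.+1)).
      by rewrite /n; congr find; rewrite -[LHS]/(iota 0 t) -{1}(subnKC lt) addSnnS iotaD.
    rewrite find_cat /= e0 addn0 size_iota.
    case: ifP => // /hasP[m]; rewrite mem_iota add0n /= => /h1.
    by rewrite ltnNge => /negbTE->.
Qed.

(** At a time late enough for both derivations the evaluator shows a single value. *)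
Lemma eval_inj c x y z : eval c x y -> eval c x z -> y = z.
Proof.
have [e [_ _ k]] := rec_eval c => /k[t1 h1] /k[t2 h2].
by have := h1 _ (leq_maxl t1 t2); rewrite (h2 _ (leq_maxr _ _)) => -[].
Qed.

(** Unbounded search for the first witness of a recursive predicate, followed by a recursive
    read-off. The explicit algorithms below are given in this form. *)
Lemma eval_search (P : nat -> nat -> bool) (g : nat -> nat -> nat) :
  rec2 P -> rec2 g -> exists c, forall x y, eval c x y <->
    exists n, [/\ P x n, forall m, m < n -> ~~ P x m & y = g x n].
Proof.
(* [CMin] looks for a zero, so it is applied to the negation of [P]. *)
move=> rP [cg hg]; have [cP hP] : rec2 (fun x n => ~~ P x n) by rec_tac.
have {}hP x n : eval cP (npair x n) (~~ P x n) by have := hP (npair x n); rewrite npairK.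
have {}hg x n : eval cg (npair x n) (g x n) by have := hg (npair x n); rewrite npairK.
exists (CComp cg (CPair CId (CMin cP))) => x y; split=> [H|[n [Pn Pm ->]]]; last first.
  apply: eComp (hg _ _); apply: ePair; first exact: eId.
  apply: eMin => [|m /Pm nP]; first by have := hP x n; rewrite Pn.
  by exists 0; have := hP x m; rewrite nP.
inversion H as [| | | | | |? ? ? z ? gz fy| | |]; subst.
inversion gz as [| | | | |? ? ? a b Ha Hb| | | |]; subst.
inversion Ha; subst; rewrite (eval_inj fy (hg _ _)).
inversion Hb as [| | | | | | | | |? ? ? H0 Hlt]; subst.
exists b; split => //.
  by have := eval_inj H0 (hP _ _); case: (P a b).
move=> m /Hlt[k Hk]; by have := eval_inj Hk (hP _ _); case: (P a m).
Qed.

(** * Strings, Kraft inequality and Kraft-Chaitin machines *)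

Lemma enc_inj : injective enc.
Proof.
elim=> [|b s IHs] [|b' s'] //=; try lia.
move=> E; have Eb : b = b' by have := congr1 odd E; case: b b' {E} => -[] //=; lia.
by rewrite Eb (IHs s') //; lia.
Qed.

Lemma enc_surj n : exists s, enc s = n.
Proof.
have [k] := ubnP n; elim: k n => // k IHk [|n] lt; first by exists [::].
have [|s Es] := IHk n./2; first by lia.
exists (odd n :: s) => /=; rewrite Es; have := odd_double_half n; lia.
Qed.

(** An inverse of [enc] obtained by choice; that string functions are recursive is proved on codes,
    by way of [rec_foldl]. *)
Definition dec n : bitseq := sval (cid (enc_surj n)).

Lemma decK : cancel dec enc.
Proof. by move=> n; rewrite /dec; case: cid. Qed.

Lemma encK : cancel enc dec.
Proof. by move=> s; apply: enc_inj; rewrite decK. Qed.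

Lemma size_le_enc s : size s <= enc s.
Proof. by elim: s => //= b s; lia. Qed.

Lemma size_dec_le x : size (dec x) <= x.
Proof. by rewrite -{2}[x]decK size_le_enc. Qed.

Lemma rec_foldl (h : nat -> nat -> nat) a0 : rec2 h ->
  rec (fun x => foldl (fun a (b : bool) => h a b) a0 (dec x)).
Proof.
(* The state holds the accumulator and the code [k] of the unread string. For [k > 0] the first bit
   is [~~ odd k] and the rest has code [k.-1 %/ 2]. Since a string is no longer than its code, [x]
   steps suffice, and surplus steps idle. *)
move=> rh; pose step st := if (unpair st).2 == 0 then st else
  npair (h (unpair st).1 (~~ odd (unpair st).2)) ((unpair st).2.-1 %/ 2).
have: rec (fun x => (unpair (iteri x (fun=> step) (npair a0 x))).1).
  by rewrite /step; rec_tac.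
have iterE st n : iteri n (fun=> step) st = iter n step st.
  by elim: n => //= n ->.
apply: rec_eq => x; rewrite iterE -{2}[x]decK.
have := size_dec_le x; move: {2 3}x => n; elim: (dec x) n a0 => [|b s IHs] n a /= lt.
  elim: n {lt} => [|n IHn]; rewrite ?npairK //.
  by rewrite iterSr {2}/step npairK.
case: n lt => // n lt; rewrite iterSr {2}/step npairK /= addnAC addn1 /=.
rewrite -(IHs n) //; congr (unpair (iter _ _ (npair (h _ _) _))).1.
  by rewrite oddD odd_double; case: b.
by rewrite -muln2 divnMDl // (@divn_small b) ?addn0; case: b.
Qed.

(* The first bit is the most significant one, unlike in [enc]. *)
Definition vb (s : bitseq) := foldl (fun a (b : bool) => a * 2 + b) 0 s.

Lemma vb_rcons s b : vb (rcons s b) = vb s * 2 + b.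
Proof. by rewrite /vb foldl_rcons. Qed.

Lemma vb_cat p r : vb (p ++ r) = vb p * 2 ^ size r + vb r.
Proof.
elim/last_ind: r => [|r b IHr]; first by rewrite cats0 muln1 addn0.
by rewrite -rcons_cat !vb_rcons IHr size_rcons expnS; lia.
Qed.

Lemma vb_lt s : vb s < 2 ^ size s.
Proof.
by elim/last_ind: s => // s b IHs; rewrite vb_rcons size_rcons expnS; case: b; lia.
Qed.

Lemma vb_ex n v : v < 2 ^ n -> exists2 s, size s = n & vb s = v.
Proof.
elim: n v => [|n IHn] v; first by rewrite ltnS leqn0 => /eqP->; exists [::].
rewrite expnS => lt; have [|s ss vs] := IHn v./2; first by lia.
by exists (rcons s (odd v)); rewrite ?size_rcons ?vb_rcons ?ss ?vs //; lia.
Qed.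

Lemma vb_inj s t : size s = size t -> vb s = vb t -> s = t.
Proof.
elim/last_ind: s t => [|s b IHs] t; first by move/esym/size0nil->.
case/lastP: t => [|t b']; first by rewrite size_rcons.
rewrite !size_rcons !vb_rcons => -[/IHs{}IHs] E.
have Eb : b = b' by move: E; case: b; case: b'; lia.
by rewrite Eb IHs //; lia.
Qed.

(** With [s] read as the dyadic interval from [vb s / 2 ^ size s] to [(vb s).+1 / 2 ^ size s], this
    is the inclusion of the interval of [q] in that of [p], cleared of denominators. *)
Lemma prefix_vb p q : prefix p q ->
  vb p * 2 ^ size q <= vb q * 2 ^ size p /\ (vb q).+1 * 2 ^ size p <= (vb p).+1 * 2 ^ size q.
Proof.
move=> /prefixP[r ->]; rewrite vb_cat size_cat expnD; have := vb_lt r.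
by move: (vb p) (vb r) (2 ^ size p) (2 ^ size r) => a b c d; nia.
Qed.

Lemma rec_size f : rec f -> rec (fun x => size (dec (f x))).
Proof.
apply: (rec_comp (g := fun x => size (dec x))).
have: rec (fun x => foldl (fun a (b : bool) => a.+1) 0 (dec x)).
  by apply: (rec_foldl (h := fun a _ => a.+1)); rec_tac.
apply: rec_eq => x; elim/last_ind: (dec x) => // s b.
by rewrite foldl_rcons size_rcons => ->.
Qed.

Lemma rec_vb f : rec f -> rec (fun x => vb (dec (f x))).
Proof.
apply: (rec_comp (g := fun x => vb (dec x))).
by apply: (rec_foldl (h := fun a b => a * 2 + b)); rec_tac.
Qed.

(** Induction on [L]. If the empty string occurs, it is the only member; otherwise split by the
    first bit, which [tl] strips. *)
Lemma kraft_nat (A : seq bitseq) L : uniq A ->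
  {in A &, forall p q, prefix p q -> p = q} -> {in A, forall p, size p <= L} ->
  \sum_(p <- A) 2 ^ (L - size p) <= 2 ^ L.
Proof.
elim: L A => [|L IHL] A uA pA sA.
  have nilA p : p \in A -> p = [::] by move/sA; rewrite leqn0 => /nilP.
  case: A uA {pA sA} nilA => [|p [|q A]] /= uA nilA; rewrite ?big_nil ?big_seq1 //.
  have /nilA qE : q \in [:: p, q & A] by rewrite !inE eqxx orbT.
  by move: uA; rewrite qE (nilA p) ?mem_head // !inE eqxx.
case: (boolP ([::] \in A)) => [nA|nA].
  have E : perm_eq A [:: [::]].
    apply: uniq_perm => // p; rewrite inE; apply/idP/eqP => [pAi|->//].
    by apply/esym/pA => //; exact: prefix0s.
  by rewrite (perm_big _ E) big_seq1.
pose tl b (p : bitseq) := if p is b' :: p' then if b' == b then Some p' else None else None.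
have tlK b : ocancel (tl b) (cons b) by case=> [//|b' p] /=; case: eqP => // ->.
have mem_tl b p : (p \in pmap (tl b) A) = (b :: p \in A).
  rewrite mem_pmap; apply/mapP/idP => [[[|b' q] // qA]|bpA]; last first.
    by exists (b :: p) => //=; rewrite eqxx.
  by rewrite /tl; case: eqP => // <- [->].
have IH b : \sum_(p <- pmap (tl b) A) 2 ^ (L - size p) <= 2 ^ L.
  apply: IHL.
  - exact: (pmap_uniq (tlK b)).
  - move=> p q; rewrite !mem_tl => /pA h /h /=; rewrite eqxx.
    by move=> {}h /h[].
  - by move=> p; rewrite mem_tl => /sA.
suff -> : \sum_(p <- A) 2 ^ (L.+1 - size p) = \sum_(p <- pmap (tl false) A) 2 ^ (L - size p)
    + \sum_(p <- pmap (tl true) A) 2 ^ (L - size p).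
  by rewrite expnS mul2n -addnn leq_add.
elim: A nA {uA pA sA mem_tl IH} => [|[|b p] A IHA]; rewrite ?big_nil //.
rewrite inE /= => /IHA{}IHA; rewrite big_cons IHA subSS.
by case: b; rewrite /= big_cons; [rewrite addnCA|rewrite addnA].
Qed.

Local Open Scope ring_scope.

Lemma exp2V_nat (R : realType) L n : (n <= L)%N ->
  ((2 ^ (L - n))%N%:R : R) = 2 ^+ L * 2 ^- n.
Proof. by move=> le; rewrite natrX expfB_cond ?pnatr_eq0. Qed.

Lemma kraft (R : realType) (A : seq bitseq) : uniq A ->
  {in A &, forall p q, prefix p q -> p = q} -> \sum_(p <- A) (2 : R) ^- size p <= 1.
Proof.
move=> uA pA; pose L := (\max_(p <- A) size p)%N.
have sA p : p \in A -> (size p <= L)%N by move=> pA'; exact: leq_bigmax_seq.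
have := kraft_nat uA pA sA; rewrite -(ler_nat R) natr_sum.
rewrite (eq_big_seq (fun p => 2 ^+ L * 2 ^- size p)); last first.
  by move=> p /sA; exact: exp2V_nat.
by rewrite -mulr_sumr natrX ger_pMr ?exprn_gt0.
Qed.

(** Request [i] owns the interval from [S i] to [S i.+1], of length [2^-(len i)]. It contains an
    aligned dyadic cell of half that length, whose string becomes the program; the halving costs the
    extra bit. *)
Lemma kraft_chaitin (R : realType) (len out : nat -> nat) (act : nat -> bool) :
  rec len -> rec out -> recb act ->
  (forall I, \sum_(i < I | act i) (2 : R) ^- len i <= 1) ->
  exists2 C, prefix_free_machine C &
    forall i, act i -> exists2 p, size p = (len i).+1 & eval C (enc p) (out i).
Proof.
move=> rl ro ra S1.
pose S I : R := \sum_(i < I | act i) 2 ^- len i.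
(* [M i] bounds [len j] for all [j <= i], so that [S i] is the integer [N i] over [2 ^ M i]. *)
pose M i := (\sum_(j < i.+1) len j)%N.
pose N i := (\sum_(j < i) act j * 2 ^ (M i - len j))%N.
(* The number of the first cell of length [2^-(len i + 1)] that starts strictly to the right of
   [S i]. *)
pose v i := ((N i * 2 ^ (len i).+1) %/ 2 ^ M i).+1.
have SS i : act i -> S i.+1 = S i + 2 ^- len i.
  by move=> ai; rewrite /S big_mkcond big_ord_recr /= ai -big_mkcond.
have Sle i j : (i <= j)%N -> S i <= S j.
  elim: j => [|j IHj]; first by rewrite leqn0 => /eqP->.
  rewrite leq_eqVlt => /predU1P[->//|/IHj/le_trans]; apply.
  rewrite {2}/S big_mkcond big_ord_recr /= -big_mkcond lerDl.
  by case: (act j); rewrite ?invr_ge0 ?exprn_ge0.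
have NS i : (N i)%:R = S i * 2 ^+ M i.
  rewrite /N /S natr_sum mulr_suml [RHS]big_mkcond; apply: eq_bigr => j _.
  case: (act j); rewrite ?mul0n // mul1n exp2V_nat; first by rewrite mulrC.
  by rewrite /M (bigD1 (widen_ord (leqnSn i) j)) //= leq_addr.
have gt0 n : (0 : R) < 2 ^+ n by rewrite exprn_gt0.
have v_gt i : S i * 2 ^+ (len i).+1 < (v i)%:R.
  rewrite -(ltr_pM2r (gt0 (M i))) mulrAC -NS -natrX -natrM -natrX -natrM ltr_nat.
  by rewrite /v ltn_ceil // expn_gt0.
have v_le i : act i -> (v i).+1%:R <= S i.+1 * 2 ^+ (len i).+1.
  have E l : (2 : R) ^- l * 2 ^+ l.+1 = 2 by rewrite exprSr mulrA mulVf ?mul1r ?gt_eqF.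
  move=> ai; rewrite SS // mulrDl E /v -[(_ %/ _).+2]addn2 natrD lerD2r.
  rewrite -(ler_pM2r (gt0 (M i))) (mulrAC (S i)) -NS -!natrX -!natrM ler_nat.
  exact: leq_trunc_div.
have v_lt i : act i -> (v i < 2 ^ (len i).+1)%N.
  move=> ai; rewrite -(ler_nat R) (le_trans (v_le _ ai)) // natrX ger_pMl ?gt0 //.
  exact: S1.
pose P x i := [&& act i, size (dec x) == (len i).+1 & vb (dec x) == v i].
(* For [i < j] the cell of [i] ends at or before [S i.+1 <= S j], and the cell of [j] starts beyond
   it; a prefix relation would make the cells nested. *)
have Pdisj x y i j : P x i -> P y j -> prefix (dec x) (dec y) -> i = j.
  move=> /and3P[ai /eqP si /eqP vi] /and3P[aj /eqP sj /eqP vj] /prefix_vb.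
  rewrite si vi sj vj; set Li := (len i).+1; set Lj := (len j).+1 => -[h1 h2].
  have [lt|lt|//] := ltngtP i j.
    have : (v j)%:R * 2 ^+ Li < ((v i).+1)%:R * 2 ^+ Lj :> R.
      rewrite -!natrX -!natrM ltr_nat; apply: leq_trans h2.
      by rewrite ltn_pmul2r // expn_gt0.
    rewrite ltNge => /negP[]; apply: (@le_trans _ _ (S i.+1 * 2 ^+ Li * 2 ^+ Lj)).
      by rewrite ler_wpM2r ?v_le ?(ltW (gt0 _)).
    rewrite mulrAC ler_wpM2r ?(ltW (gt0 _)) //.
    by apply: le_trans (ltW (v_gt j)); rewrite ler_wpM2r ?Sle ?(ltW (gt0 _)).
  have : (v i)%:R * 2 ^+ Lj < ((v j).+1)%:R * 2 ^+ Li :> R.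
    rewrite -!natrX -!natrM ltr_nat; apply: leq_ltn_trans h1 _.
    by rewrite ltn_pmul2r // expn_gt0.
  rewrite ltNge => /negP[]; apply: (@le_trans _ _ (S j.+1 * 2 ^+ Lj * 2 ^+ Li)).
    by rewrite ler_wpM2r ?v_le ?(ltW (gt0 _)).
  rewrite mulrAC ler_wpM2r ?(ltW (gt0 _)) //.
  by apply: le_trans (ltW (v_gt i)); rewrite ler_wpM2r ?Sle ?(ltW (gt0 _)).
have rP : rec2 P.
  have rM : rec M.
    by apply: (rec_sum (F := fun _ j => len j) (f := fun i => i.+1)); rec_tac.
  have rN : rec N.
    apply: (rec_sum (F := fun i j => (act j * 2 ^ (M i - len j))%N) (f := fun i => i)); by rec_tac.
  have rv : rec v by rewrite /v; rec_tac.
  have rs := rec_size rec_id; have rvb := rec_vb rec_id.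
  by rewrite /P; rec_tac; [exact/rec_size/rec_fst/rec_id|exact/rec_vb/rec_fst/rec_id].
have [C CP] : exists c, forall x y, eval c x y <-> exists n,
    [/\ P x n, forall m, (m < n)%N -> ~~ P x m & y = out n].
  by apply: (eval_search (g := fun _ n => out n) rP); rec_tac.
exists C => [p q [s /CP[i [Pi _ _]]] [t /CP[j [Pj _ _]]] pq|i ai].
  have E : i = j by apply: Pdisj Pi Pj _; rewrite !encK.
  move: Pi Pj; rewrite E /P !encK => /and3P[_ /eqP si /eqP vi] /and3P[_ /eqP sj /eqP vj].
  by apply: vb_inj; rewrite ?si ?vi.
have [p sp vp] := vb_ex (v_lt i ai).
have Pi : P (enc p) i by rewrite /P encK sp vp ai !eqxx.
exists p => //; apply/CP; exists i; split=> // m lt; apply/negP => Pm.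
by move: lt; rewrite (Pdisj _ _ _ _ Pm Pi) ?ltnn // prefix_refl.
Qed.

(** * Short strings *)

Lemma runs_inj C p s t : runs C p s -> runs C p t -> s = t.
Proof. by move=> h1 h2; apply: enc_inj; exact: eval_inj h1 h2. Qed.

(** A program determines its output, so [f] is injective on [A] and the chosen programs form a
    prefix-free set. *)
Lemma kraft_machine (R : realType) V (A : seq bitseq) (f : bitseq -> bitseq) :
  prefix_free_machine V -> uniq A -> {in A, forall s, runs V (f s) s} ->
  \sum_(s <- A) (2 : R) ^- size (f s) <= 1.
Proof.
move=> pV uA rA; rewrite -(big_map f xpredT (fun p => 2 ^- size p)); apply: kraft.
  rewrite map_inj_in_uniq // => s t /rA hs /rA + E; rewrite -E; exact: runs_inj.
by move=> _ _ /mapP[s /rA hs ->] /mapP[t /rA ht ->]; apply: pV; [exists s|exists t].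
Qed.

(** The summation condition of [ThetaBar], with the infimum in [Hc] replaced by a witness program
    ([Hc_ltP]). *)
Definition short (R : realType) V (T : R) (s : bitseq) :=
  exists2 p, runs V p s & (size p)%:R < T * (size s)%:R.

Lemma Hc_ltP (R : realType) V (x : R) s :
  (Hc V s < x%:E)%E <-> exists2 p, runs V p s & (size p)%:R < x.
Proof.
split=> [/ereal_inf_lt[_ [p hp <-]]|[p hp lt]]; first by rewrite lte_fin; exists p.
by apply/ereal_inf_ltP; exists (size p)%:R%:E; [exists p|].
Qed.

Lemma ThetaBar_ge (R : realType) V (T : R) (A : seq bitseq) :
  uniq A -> {in A, forall s, short V T s} ->
  ((\sum_(s <- A) 2 ^- size s)%:E <= ThetaBar V T)%E.
Proof.
move=> uA sA; apply: esum_ge; exists [set` A]%classic.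
  by split; [exact: finite_seq|move=> s /= /sA h; apply/Hc_ltP].
by rewrite -fsbig_seq // sumEFin.
Qed.

Lemma ThetaBar_le (R : realType) V (T : R) x :
  (forall A : seq bitseq, uniq A -> {in A, forall s, short V T s} ->
    \sum_(s <- A) (2 : R) ^- size s <= x) ->
  (ThetaBar V T <= x%:E)%E.
Proof.
move=> h; apply: ge_ereal_sup => _ [D [/finite_seqP[A ->] DA] <-].
have -> : [set` A]%classic = [set` undup A]%classic.
  by apply/seteqP; split=> s /=; rewrite mem_undup.
rewrite -fsbig_seq ?undup_uniq // sumEFin lee_fin; apply: h; first exact: undup_uniq.
by move=> s; rewrite mem_undup => /DA /Hc_ltP.
Qed.

Lemma ThetaBar_pinfty (R : realType) V (T : R) :
  (forall N, exists2 A : seq bitseq, uniq A & {in A, forall s, short V T s} /\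
    N%:R <= \sum_(s <- A) (2 : R) ^- size s) ->
  ThetaBar V T = +oo%E.
Proof.
move=> h; apply/eq_infty => x.
have [A uA [sA lA]] := h (Num.bound `|x|).
apply: le_trans (ThetaBar_ge uA sA); rewrite lee_fin; apply: le_trans lA.
by rewrite (le_trans (ler_norm _)) // ltW // archi_boundP.
Qed.

Definition strings n : seq bitseq := [seq val t | t <- enum {: n.-tuple bool}].

Lemma strings_uniq n : uniq (strings n).
Proof. by rewrite map_inj_uniq ?enum_uniq //; exact: val_inj. Qed.

Lemma mem_strings n s : (s \in strings n) = (size s == n).
Proof.
apply/mapP/eqP => [[t _ ->]|<-]; first by rewrite size_tuple.
by exists (in_tuple s); rewrite ?mem_enum.
Qed.

Lemma size_strings n : size (strings n) = (2 ^ n)%N.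
Proof. by rewrite size_map -cardE card_tuple card_bool. Qed.

Lemma sum_strings (R : realType) n : \sum_(s <- strings n) (2 : R) ^- size s = 1.
Proof.
rewrite (eq_big_seq (fun=> 2 ^- n)) => [|s]; last by rewrite mem_strings => /eqP->.
rewrite big_const_seq count_predT size_strings iter_addr_0 -[LHS]mulr_natl natrX.
by rewrite mulfV ?expf_neq0 ?pnatr_eq0.
Qed.

Lemma exp2V_le (R : realType) m n : (m <= n)%N -> (2 : R) ^- n <= 2 ^- m.
Proof. by move=> le; rewrite lef_pV2 ?posrE ?exprn_gt0 // ler_weXn2l // ler1n. Qed.

Lemma short_programs (R : realType) V (T : R) : exists f : bitseq -> bitseq,
  forall s, short V T s -> runs V (f s) s /\ (size (f s))%:R < T * (size s)%:R.
Proof.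
have /choice[f hf] : forall s, exists p, short V T s -> runs V p s /\ (size p)%:R < T * (size s)%:R.
  move=> s; have [[p ? ?]|n] := pselect (short V T s); first by exists p.
  by exists [::].
by exists f.
Qed.

Lemma short_size (R : realType) (T : R) n m : T <= 1 -> n%:R < T * m%:R -> (n < m)%N.
Proof. by move=> T1 /lt_le_trans h; rewrite -(ltr_nat R); apply: h; rewrite ler_piMl. Qed.

(** For [T <= 1] a short string is longer than one of its programs, so Kraft's inequality for
    programs bounds the sum. *)
Lemma short_sum_le1 (R : realType) V (T : R) (A : seq bitseq) :
  prefix_free_machine V -> T <= 1 -> uniq A -> {in A, forall s, short V T s} ->
  \sum_(s <- A) (2 : R) ^- size s <= 1.
Proof.
move=> pV T1 uA sA; have [f hf] := short_programs V T.
have fA : {in A, forall s, runs V (f s) s} by move=> s /sA /hf[].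
apply: le_trans (kraft_machine R pV uA fA); rewrite !big_seq; apply: ler_sum => s /sA /hf[_ lt].
by apply/exp2V_le/ltnW; exact: short_size lt.
Qed.

Lemma ThetaBar_fin (R : realType) V (T : R) : prefix_free_machine V -> T <= 1 ->
  ThetaBar V T \is a fin_num.
Proof.
move=> pV T1; rewrite ge0_fin_numE.
  apply: (@le_lt_trans _ _ 1%:E); last exact: ltry.
  by apply: ThetaBar_le => A; exact: short_sum_le1.
by have := @ThetaBar_ge R V T [::]; rewrite big_nil; apply.
Qed.

(** If all strings of length [n] were short, each would have a program of length below [n]. These
    programs would have total weight at least 2, against Kraft's inequality. *)
Lemma not_short (R : realType) V (T : R) n : prefix_free_machine V -> T <= 1 ->
  exists2 s, size s = n & ~ short V T s.
Proof.
move=> pV T1; apply: contrapT => /forall2NP h; have [f hf] := short_programs V T.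
have sA : {in strings n, forall s, short V T s}.
  by move=> s; rewrite mem_strings => /eqP E; have [//|/contrapT] := h s.
have fA : {in strings n, forall s, runs V (f s) s} by move=> s /sA /hf[].
have := kraft_machine R pV (strings_uniq n) fA; apply/negP; rewrite -ltNge.
have lt1 : 1 < 2 * \sum_(s <- strings n) (2 : R) ^- size s.
  by rewrite sum_strings mulr1 ltr1n.
apply: lt_le_trans lt1 _; rewrite mulr_sumr !big_seq.
apply: ler_sum => s /sA /hf[_ /(short_size T1) lt].
by have := exp2V_le R lt; rewrite exprS invfM ler_pdivlMl.
Qed.

(** The unary part of [E s] announces the number of blocks of length [L], hence the length of [s],
    and makes the code prefix-free at a cost of only [size s / L + 1] bits. *)
Lemma block_machine L : exists2 C, prefix_free_machine C & forall s, (L %| size s)%N ->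
  exists2 p, runs C p s & size p = (size s %/ L + 1 + size s)%N.
Proof.
pose q (s : bitseq) := (size s %/ L)%N.
pose E s := nseq (q s) true ++ false :: s.
have EP s t : prefix (E s) (E t) -> q s = q t /\ prefix s t.
  rewrite /E; elim: (q s) (q t) => [|m IHm] [|n] //=.
  by move/IHm => -[->].
pose sm y := (size (dec y) %% L)%N.
pose P p y := ((sm y == 0) && (enc (E (dec y)) == p))%N.
have rP : rec2 P.
  (* On codes, prepending [true] is [2 * a + 2] and prepending [false] is [2 * a + 1]. *)
  pose e y := iteri (size (dec y) %/ L)%N (fun _ a => 2 * a + 2)%N (2 * y + 1)%N.
  have eE y : enc (E (dec y)) = e y.
    rewrite /e /E /q; elim: (_ %/ L)%N => [|m /= <-] /=; first by rewrite decK; lia.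
    lia.
  have rs0 := rec_size rec_id; have re : rec e by rewrite /e; rec_tac.
  have rs : rec sm by rewrite /sm; rec_tac.
  have -> : (fun z => P (unpair z).1 (unpair z).2 : nat) = (fun z =>
    (sm (unpair z).2 == 0%N) && (e (unpair z).2 == (unpair z).1) : nat).
    by apply/funext => z; rewrite /P eE.
  by rec_tac.
have [C CP] := eval_search rP (rec_snd rec_id : rec2 (fun _ y => y)).
have CE p s : runs C p s <-> (L %| size s)%N /\ p = E s.
  rewrite /runs CP; split=> [[n [/andP[n1 /eqP n2] _ E1]]|[d ->]].
    by move: n1 n2; rewrite /sm -E1 encK => d /enc_inj->.
  exists (enc s); split=> //; first by rewrite /P /sm encK eqxx [_ == _]d.
  move=> m lt; apply/negP => /andP[_ /eqP /enc_inj Em].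
  have [_] : q (dec m) = q s /\ prefix (dec m) s by apply: EP; rewrite Em prefix_refl.
  have [_] : q s = q (dec m) /\ prefix s (dec m) by apply: EP; rewrite Em prefix_refl.
  move=> /size_prefix h1 /[dup] h2 /size_prefix h3.
  move: h2; rewrite prefixE take_oversize // => /eqP h.
  by move: lt; rewrite h decK ltnn.
exists C => [p p' [s /CE[ds ->]] [t /CE[dt ->]] /EP[eq pst]|s ds].
  have Est : size s = size t by rewrite -(divnK ds) -(divnK dt) -/(q s) eq.
  by move: pst; rewrite prefixE Est take_size => /eqP->.
exists (E s); first exact/CE.
by rewrite size_cat size_nseq /= /q; lia.
Qed.

Lemma ThetaBar_gt1 (R : realType) V (T : R) : optimal V -> 1 < T -> ThetaBar V T = +oo%E.
Proof.
move=> [_ optV] T1; pose L := (Num.bound (2 / (T - 1))).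
have L2 : 2 <= (T - 1) * L%:R.
  rewrite -ler_pdivrMl ?subr_gt0 // mulrC ltW // archi_boundP //.
  by rewrite divr_ge0 // subr_ge0 ltW.
have L0 : (0 < L)%N.
  by rewrite lt0n; apply/eqP => L0; move: L2; rewrite L0 mulr0 leNgt ltr0n.
have [C pC CP] := block_machine L; have [d dP] := optV C pC.
(* For length [L * k] the program exceeds the string by at most [k + 1 + d] bits, while
   [(T - 1) * L * k >= 2 * k] are allowed; [k >= d + 2] makes this strict. *)
have Ls s m : size s = (L * (d + 2 + m))%N -> short V T s.
  move=> ss; have [|p rp sp] := CP s; first by rewrite ss dvdn_mulr.
  have [q [rq sq]] := dP _ _ rp; exists q => //.
  have : (size q <= L * (d + 2 + m) + (2 * d + 3 + m))%N.
    by apply: leq_trans sq _; rewrite sp ss mulKn //; lia.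
  rewrite -(ler_nat R) natrD => /le_lt_trans; apply.
  rewrite ss; have -> : T = 1 + (T - 1) by rewrite addrC subrK.
  rewrite mulrDl mul1r ltrD2l natrM mulrA.
  apply: (@lt_le_trans _ _ (2 * (d + 2 + m)%:R)); last by rewrite ler_wpM2r.
  by rewrite -natrM ltr_nat; lia.
apply: ThetaBar_pinfty => N.
(* The set of all strings of one length has weight 1, so [N] different lengths give [N]. *)
pose A := flatten [seq strings (L * (d + 2 + m)) | m <- iota 0 N].
exists A; last split.
- rewrite {}/A; elim: N => // N IHN; rewrite -[N.+1]addn1 iotaD map_cat flatten_cat /= cats0.
  rewrite cat_uniq IHN strings_uniq andbT /=; apply/hasPn => s.
  rewrite mem_strings => /eqP ss; apply/negP => /flatten_mapP[m].
  rewrite mem_iota /= mem_strings ss eqn_pmul2l // eqn_add2l add0n; lia.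
- by move=> s /flatten_mapP[m _]; rewrite mem_strings => /eqP /Ls.
- rewrite /A big_flatten /= big_map; under eq_bigr do rewrite sum_strings.
  by rewrite big_const_seq count_predT size_iota iter_addr_0.
Qed.

(** * Enumeration of the short strings *)

(** The fractions [a j / (b j).+1] have supremum [T], not necessarily in increasing order; the
    inequalities are stated without division. *)
Definition lower_approx (R : realType) (T : R) (a b : nat -> nat) :=
  [/\ rec a, rec b, forall j, (a j)%:R <= T * (b j).+1%:R &
      forall x, x < T -> exists j, x * (b j).+1%:R < (a j)%:R].

(** Stage [t] admits only codes below [t], so each stage is a finite set that can be listed. *)
Definition enumerates (R : realType) V (T : R) (D : nat -> nat -> bool) :=
  [/\ rec2 D, forall x t, D x t -> (x < t)%N, forall x t u, (t <= u)%N -> D x t -> D x u &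
      forall x, short V T (dec x) <-> exists t, D x t].

Lemma short_enumerable (R : realType) V (T : R) a b :
  lower_approx T a b -> exists D, enumerates V T D.
Proof.
move=> [ra rb aT Ta]; have [e [re se ke]] := rec_eval V.
pose sz x := size (dec x); have rs : rec sz by apply: rec_size rec_id.
(* Witnesses are sought below [t]: a program [p], a time [u] at which its output [x] is seen, and an
   index [j] whose fraction already exceeds [sz p / sz x]. *)
pose D x t := (x < t)%N && has (fun p => has (fun u => has (fun j =>
  (e p u == x.+1) && (sz p * (b j).+1 < a j * sz x)%N) (iota 0 t)) (iota 0 t)) (iota 0 t).
exists D; split; first by rewrite /D; rec_tac.
- by move=> x t /andP[].
- have sub t u y : (t <= u)%N -> y \in iota 0 t -> y \in iota 0 u.
    by rewrite !mem_iota /= => le /leq_trans; apply.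
  move=> x t u le /andP[lt /hasP[p pt /hasP[v vt /hasP[j jt h]]]].
  rewrite /D (leq_trans lt le); apply/hasP; exists p; first exact: sub pt.
  by apply/hasP; exists v; [exact: sub vt|apply/hasP; exists j => //; exact: sub jt].
move=> x; split=> [[p rp lt]|[t /andP[_ /hasP[p _ /hasP[u _ /hasP[j _ /andP[/eqP/se h lt]]]]]]].
- have s0 : 0 < (sz x)%:R :> R.
    rewrite ltr0n lt0n; apply/eqP => s0; move: lt.
    by rewrite -/(sz x) s0 mulr0 ltNge ler0n.
  move: lt; rewrite -ltr_pdivrMr // => /Ta[j]; rewrite mulrAC ltr_pdivrMr //.
  rewrite -!natrM ltr_nat => lt.
  have [t0 kt] := ke _ _ rp.
  pose t := (maxn (maxn x (enc p)) (maxn t0 j)).+1; exists t.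
  have [xt pt ut jt] : [/\ (x < t)%N, (enc p < t)%N, (t0 < t)%N & (j < t)%N].
    by rewrite /t !ltnS !leq_max !leqnn !orbT.
  rewrite /D xt; apply/hasP; exists (enc p); first by rewrite mem_iota.
  apply/hasP; exists t0; first by rewrite mem_iota.
  apply/hasP; exists j; first by rewrite mem_iota.
  by rewrite kt // decK eqxx /sz encK.
- exists (dec p); first by rewrite /runs !decK.
  have b0 : 0 < (b j).+1%:R :> R by rewrite ltr0n.
  rewrite -(ltr_pM2r b0) mulrAC -natrM; apply: (@lt_le_trans _ _ (a j * sz x)%:R).
    by rewrite ltr_nat.
  by rewrite natrM ler_wpM2r.
Qed.

Definition theta (R : realType) (D : nat -> nat -> bool) t : R :=
  \sum_(x < t | D x t) 2 ^- size (dec x).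

(** The numerator of [theta] over [2 ^ t]. The subtraction is never truncated, since codes below [t]
    denote strings of length below [t]. *)
Definition theta_num (D : nat -> nat -> bool) t :=
  (\sum_(x < t) D x t * 2 ^ (t - size (dec x)))%N.

Lemma theta_numE (R : realType) D t : (theta_num D t)%:R = theta R D t * 2 ^+ t.
Proof.
rewrite /theta_num /theta natr_sum mulr_suml [RHS]big_mkcond; apply: eq_bigr => x _.
case: (D x t); rewrite ?mul0n // mul1n exp2V_nat ?(mulrC (2 ^+ t)) //.
by rewrite (leq_trans (size_dec_le x)) // ltnW.
Qed.

Lemma rec_theta_num (D : nat -> nat -> bool) : rec2 D -> rec (theta_num D).
Proof.
move=> rD; pose sz x := size (dec x); have rs : rec sz by apply: rec_size rec_id.
by apply: (rec_sum (F := fun t x => (D x t * 2 ^ (t - sz x))%N) (f := fun t => t)); rec_tac.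
Qed.

Lemma ler_sum_subset (R : realType) (I : eqType) (A B : seq I) (f : I -> R) :
  uniq A -> uniq B -> {subset A <= B} -> (forall i, 0 <= f i) ->
  \sum_(i <- A) f i <= \sum_(i <- B) f i.
Proof.
move=> uA uB AB f0; rewrite (perm_big [seq i <- B | i \in A]).
  by rewrite big_filter big_mkcond; apply: ler_sum => i _; case: ifP.
apply: uniq_perm; rewrite ?filter_uniq // => i; rewrite mem_filter.
by case: (boolP (i \in A)) => // /AB.
Qed.

Lemma exp2V_ge0 (R : realType) n : 0 <= (2 : R) ^- n.
Proof. by rewrite invr_ge0 exprn_ge0. Qed.
#[local] Hint Resolve exp2V_ge0 : core.

Definition stage (D : nat -> nat -> bool) t : seq bitseq :=
  [seq dec x | x <- iota 0 t & D x t].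

Lemma theta_stage (R : realType) D t : theta R D t = \sum_(s <- stage D t) 2 ^- size s.
Proof.
rewrite big_map big_filter /theta -(big_mkord (D^~ t) (fun x => 2 ^- size (dec x))).
by rewrite /index_iota subn0.
Qed.

Lemma stage_uniq D t : uniq (stage D t).
Proof. by rewrite map_inj_uniq ?filter_uniq ?iota_uniq //; exact: can_inj decK. Qed.

Lemma mem_stage (R : realType) V (T : R) D t s : enumerates V T D ->
  (s \in stage D t) = D (enc s) t.
Proof.
move=> [_ lt _ _]; apply/mapP/idP => [[x + ->]|h].
  by rewrite mem_filter decK => /andP[].
by exists (enc s); rewrite ?encK // mem_filter h mem_iota (lt _ _ h).
Qed.

Lemma stage_short (R : realType) V (T : R) D t : enumerates V T D ->
  {in stage D t, forall s, short V T s}.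
Proof.
move=> eD s; rewrite (mem_stage _ _ eD) => h; have [_ _ _ sD] := eD.
by rewrite -[s]encK; apply/sD; exists t.
Qed.

Lemma stage_sub (R : realType) V (T : R) D t u : enumerates V T D -> (t <= u)%N ->
  {subset stage D t <= stage D u}.
Proof.
by move=> eD le s; rewrite !(mem_stage _ _ eD); have [_ _ mD _] := eD; exact: mD.
Qed.

Lemma stage_complete (R : realType) V (T : R) D (A : seq bitseq) : enumerates V T D ->
  {in A, forall s, short V T s} -> exists t, {subset A <= stage D t}.
Proof.
move=> eD; elim: A => [|s A IHA] sA; first by exists 0%N.
have [t At] : exists t, {subset A <= stage D t}.
  by apply: IHA => x xA; apply: sA; rewrite inE xA orbT.
have [_ _ mD sD] := eD.
have /sD[u hu] : short V T (dec (enc s)) by rewrite encK; apply: sA; exact: mem_head.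
exists (maxn t u) => x; rewrite inE => /predU1P[->|/At].
  by rewrite (mem_stage _ _ eD); apply: mD hu; exact: leq_maxr.
exact/(stage_sub eD)/leq_maxl.
Qed.

(** * The stages as lower approximations of the sum *)

Section Theta.
Variables (R : realType) (V : mrcode) (T : R) (D : nat -> nat -> bool).
Hypotheses (pV : prefix_free_machine V) (T1 : T <= 1) (eD : enumerates V T D).

Local Notation Theta := (fine (ThetaBar V T)).

Lemma theta_le_Theta t : theta R D t <= Theta.
Proof.
rewrite -lee_fin fineK ?ThetaBar_fin // theta_stage.
by apply: ThetaBar_ge; [exact: stage_uniq|exact: stage_short].
Qed.

Lemma theta_mono t u : (t <= u)%N -> theta R D t <= theta R D u.
Proof.
move=> le; rewrite !theta_stage; apply: ler_sum_subset; rewrite ?stage_uniq //.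
exact: stage_sub eD le.
Qed.

Lemma theta_add t u s : (t <= u)%N -> D (enc s) u -> ~~ D (enc s) t ->
  theta R D t + 2 ^- size s <= theta R D u.
Proof.
move=> le Du Dt; rewrite !theta_stage addrC.
rewrite -(big_cons 0 +%R s (stage D t) xpredT (fun s => 2 ^- size s)).
apply: ler_sum_subset => //=; rewrite ?stage_uniq ?andbT // ?(mem_stage _ _ eD) //.
move=> x; rewrite inE => /predU1P[->|]; first by rewrite (mem_stage _ _ eD).
exact: stage_sub eD le x.
Qed.

Lemma theta_approx x : x < Theta -> exists t, x < theta R D t.
Proof.
move=> lt; apply: contrapT => /forallNP h; move: lt; apply/negP; rewrite -leNgt.
rewrite -lee_fin fineK ?ThetaBar_fin //; apply: ThetaBar_le => A uA sA.
have [t At] := stage_complete eD sA; have /negP := h t; rewrite -leNgt.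
apply: le_trans; rewrite theta_stage; apply: ler_sum_subset => //; exact: stage_uniq.
Qed.

Lemma Theta_ge0 : 0 <= Theta.
Proof. by apply: le_trans (theta_le_Theta 0); rewrite /theta big_ord0. Qed.

Lemma Theta_le1 : Theta <= 1.
Proof.
rewrite -lee_fin fineK ?ThetaBar_fin //; apply: ThetaBar_le => A.
exact: short_sum_le1.
Qed.

End Theta.

(** * Computability and randomness of the sum *)

(** Passes from rationals to their codes and shifts the domain from positive integers to [nat]. *)
Lemma total_recursive_rec f : total_recursive_posQ f ->
  exists2 m, rec m & forall n, qdec (m n) = f n.+1.
Proof.
move=> [c hc]; have /choice[m hm] : forall n, exists k, eval c n.+1 k /\ qdec k = f n.+1.
  by move=> n; exact: hc.
exists m; last by move=> n; have [] := hm n.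
by exists (CComp c CSucc) => n; apply: eComp (eSucc n) _; have [] := hm n.
Qed.

Lemma ratr_qdec (R : realType) k :
  ratr (qdec k) = (zdec (unpair k).1)%:~R / (unpair k).2.+1%:R :> R.
Proof. by rewrite /qdec; case: unpair => a b; rewrite fmorph_div rmorph_int rmorph_nat. Qed.

Lemma left_lower_approx (R : realType) (T : R) : 0 < T -> left_computable T ->
  exists a b, lower_approx T a b.
Proof.
move=> T0 [f [/total_recursive_rec[m rm mf] [fT Tf]]].
(* The negated approximations of [- T] approach [T] from below. Odd codes are the negative integers
   under [zdec]; the numerator is cut off at 0. *)
pose a j := if odd (unpair (m j)).1 then ((unpair (m j)).1.+1 %/ 2)%N else 0%N.
pose b j := (unpair (m j)).2.
have am j : (a j)%:R = Num.max 0 (- (zdec (unpair (m j)).1)%:~R) :> R.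
  rewrite /a /zdec; case: ifP => _.
    by rewrite rmorphN /= opprK divn2 max_r // ler0n.
  by rewrite max_l // oppr_le0 ler0n.
have b0 j : 0 < (b j).+1%:R :> R by rewrite ltr0n.
have fE j : ratr (f j.+1) = (zdec (unpair (m j)).1)%:~R / (b j).+1%:R :> R.
  by rewrite -mf ratr_qdec.
exists a, b; split; try by rewrite /a /b; rec_tac.
- move=> j; rewrite am ge_max mulr_ge0 ?(ltW T0) //= lerNl -mulNr.
  by rewrite -ler_pdivlMr // -fE fT.
- move=> x xT; have [x0|x0] := ltP x 0.
    by exists 0%N; rewrite am lt_max nmulr_rlt0 ?b0.
  have /cvgrPdist_lt /(_ (T - x)) := Tf; rewrite subr_gt0 => /(_ xT) [N _ hN].
  exists N; rewrite am lt_max orbC ltrNr -mulNr -ltr_pdivrMr // -fE.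
  have := hN N.+1 (leqnSn N); rewrite ltr_norml => /andP[+ _].
  by rewrite ltrBrDr => h; rewrite (_ : _ < _) //; lra.
Qed.

(** The bound [|T - z j / d j| < 1 / j.+1] without division. Replacing negative approximations by 0
    moves them closer to [T > 0]. *)
Lemma computable_nat_approx (R : realType) (T : R) : 0 < T -> computable_real T ->
  exists z d, [/\ rec z, rec d, forall j, (0 < d j)%N &
    forall j, `|T * (d j)%:R * j.+1%:R - (z j)%:R * j.+1%:R| < (d j)%:R].
Proof.
move=> T0 [f [/total_recursive_rec[m rm mf] fT]].
pose z j := if odd (unpair (m j)).1 then 0%N else ((unpair (m j)).1 %/ 2)%N.
pose d j := (unpair (m j)).2.+1.
exists z, d; split; try by rewrite /z /d; rec_tac.
move=> j; have zm : (z j)%:R = Num.max 0 (zdec (unpair (m j)).1)%:~R :> R.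
  rewrite /z /zdec; case: ifP => _; last by rewrite divn2 max_r // ler0n.
  by rewrite max_l // rmorphN oppr_le0 ler0n.
have d0 : 0 < (d j)%:R :> R by rewrite ltr0n.
have := fT j.+1 isT; rewrite -mf ratr_qdec -/(d j) -(ltr_pM2r d0) -(ltr_pM2r (ltr0Sn R j)).
rewrite (mulrAC _^-1) mulVf ?pnatr_eq0 // mul1r; apply: le_lt_trans.
have E x : `|x| * (d j)%:R * j.+1%:R = `|x * (d j)%:R * j.+1%:R| :> R.
  by rewrite !normrM !normr_nat.
rewrite {}E.
rewrite !mulrBl divfK ?gt_eqF // zm; set c := _%:~R; case: (leP 0 c) => // c0.
have Td : 0 <= T * (d j)%:R * j.+1%:R by rewrite !mulr_ge0 // ltW.
have cj : c * j.+1%:R <= 0 by rewrite nmulr_rle0.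
by rewrite mul0r subr0 !ger0_norm // ?subr_ge0 ?(le_trans cj) // lerDl oppr_ge0.
Qed.

Lemma computable_lower_approx (R : realType) (T : R) : 0 < T -> computable_real T ->
  exists a b, lower_approx T a b.
Proof.
move=> T0 /(computable_nat_approx T0)[z [d [rz rd d0 zd]]].
(* The fraction [z j / d j] lowered by its error bound [1 / j.+1], and cut off at 0. *)
pose a j := (z j * j.+1 - d j)%N; pose b j := (d j * j.+1).-1.
have bE j : (b j).+1%:R = (d j)%:R * j.+1%:R :> R.
  by rewrite -natrM /b prednK // muln_gt0 d0.
exists a, b; split; try by rewrite /a /b; rec_tac.
- move=> j; rewrite bE /a; have [le|lt] := leqP (z j * j.+1)%N (d j).
    by rewrite (eqP le) !mulr_ge0 // ltW.
  rewrite natrB ?(ltnW lt) // natrM mulrA.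
  have := zd j; rewrite ltr_norml => /andP[+ _]; lra.
(* The lowered fraction misses [T] by less than [2 / j.+1]. *)
- move=> x xT; pose j := Num.bound (2 / (T - x)).
  have jP : 2 <= (T - x) * j.+1%:R.
    rewrite -ler_pdivrMl ?subr_gt0 // mulrC ltW // (@lt_trans _ _ j%:R) ?ltr_nat //.
    by rewrite archi_boundP // divr_ge0 // subr_ge0 ltW.
  exists j; rewrite bE; apply: (@lt_le_trans _ _ ((z j * j.+1)%:R - (d j)%:R)); last first.
    rewrite /a; have [le|lt] := leqP (z j * j.+1)%N (d j); last by rewrite natrB // ltnW.
    by rewrite (eqP le) subr_le0 ler_nat.
  have := zd j; rewrite ltr_norml natrM => /andP[_].
  have : 2 * (d j)%:R <= (T - x) * j.+1%:R * (d j)%:R by rewrite ler_wpM2r.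
  move: (d j)%:R (z j)%:R (j.+1%:R) => e y w; nra.
Qed.

Lemma computable_ceil (R : realType) (T : R) : 0 < T -> computable_real T ->
  exists2 l, rec l & forall n, T * n.+1%:R <= (l n)%:R <= T * n.+1%:R + 3.
Proof.
move=> T0 /(computable_nat_approx T0)[z [d [rz rd d0 zd]]].
(* [z n * n.+1 / d n] is within 1 of [T * n.+1], and rounding down loses less than 1 more; adding 2
   yields an upper bound with excess at most 3. *)
exists (fun n => z n * n.+1 %/ d n + 2)%N; first by rec_tac.
move=> n; have d0R : 0 < (d n)%:R :> R by rewrite ltr0n.
have h1 : (z n * n.+1 %/ d n)%:R * (d n)%:R <= (z n)%:R * n.+1%:R :> R.
  by rewrite -!natrM ler_nat leq_trunc_div.
have h2 : (z n)%:R * n.+1%:R < ((z n * n.+1 %/ d n)%:R + 1) * (d n)%:R :> R.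
  by rewrite natr1 -!natrM ltr_nat ltn_ceil.
have := zd n; rewrite ltr_norml => /andP[h3 h4].
rewrite natrD -(ler_pM2r d0R) -[X in _ && X](ler_pM2r d0R); apply/andP.
move: (d n)%:R d0R h1 h2 h3 h4 => e e0; move: (_ %/ _)%N%:R (z n)%:R n.+1%:R => q y w *.
by split; nra.
Qed.

Lemma Theta_left_computable (R : realType) V (T : R) D : prefix_free_machine V -> T <= 1 ->
  enumerates V T D -> left_computable (fine (ThetaBar V T)).
Proof.
move=> pV T1 eD; have [rD _ _ _] := eD; have rt := rec_theta_num rD.
(* The code [2 * k - 1] stands for [- k] under [zdec] (truncation gives the right code 0 for
   [k = 0]), and [qdec] adds one to the denominator. *)
pose g n := npair (2 * theta_num D n).-1 (2 ^ n).-1.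
have [c hc] : rec g by rewrite /g; rec_tac.
have gE n : ratr (qdec (g n)) = - theta R D n.
  rewrite ratr_qdec npairK /= prednK ?expn_gt0 // natrX.
  have -> : zdec (2 * theta_num D n).-1 = - (theta_num D n)%:Z.
    rewrite /zdec; case: (theta_num D n) => [//|k].
    have -> : (2 * k.+1).-1 = k.*2.+1 by lia.
    by rewrite /= odd_double; congr (- Posz _); lia.
  by rewrite rmorphN /= -pmulrn theta_numE mulNr mulfK ?expf_neq0 ?pnatr_eq0.
exists (fun n => qdec (g n)); split; first by exists c => n _; exists (g n).
split=> [n _|]; first by rewrite gE lerN2; exact: theta_le_Theta.
apply/cvgrPdist_lt => e e0; set Th := fine _.
have [|t0 lt] := theta_approx pV T1 eD (x := Th - e); first by rewrite gtrBl.
exists t0 => // t /= le; rewrite gE opprK addrC ltr_norml; apply/andP; split.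
  by have := theta_mono eD le; rewrite ltrBrDl; exact: lt_le_trans.
by apply: le_lt_trans e0; rewrite subr_le0; exact: theta_le_Theta.
Qed.

Lemma restr_rcons (R : realType) (x : R) n : restr x n.+1 = rcons (restr x n) (bit x n.+1).
Proof. by rewrite /restr -cats1 -[n.+1]addn1 iotaD map_cat /= addn1. Qed.

Lemma size_restr (R : realType) (x : R) n : size (restr x n) = n.
Proof. by rewrite size_map size_iota. Qed.

(** If [v] is the floor of [2 ^+ n * y], that of [2 ^+ n.+1 * y] is [2 * v] or [2 * v + 1], so its
    parity is the bit to append. *)
Lemma vb_restr (R : realType) (x : R) n :
  (vb (restr x n))%:R <= 2 ^+ n * (x - (Num.floor x)%:~R) < (vb (restr x n)).+1%:R.
Proof.
set y := x - _; elim: n => [|n /andP[le lt]].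
  have /andP[h1 h2] := floor_itv x; rewrite expr0 mul1r /y subr_ge0 h1 /=.
  by move: h2; rewrite intrD /= ltrBlDl.
rewrite restr_rcons vb_rcons /bit -/y; set v := vb _ in le lt *.
have {}le : (v * 2)%:R <= 2 ^+ n.+1 * y by rewrite natrM mulrC exprS -mulrA ler_pM2l.
have {}lt : 2 ^+ n.+1 * y < (v * 2).+2%:R.
  have -> : (v * 2).+2 = (2 * v.+1)%N by lia.
  by rewrite natrM exprS -mulrA ltr_pM2l.
move: (2 ^+ n.+1 * y) le lt => w le lt.
have [lt1|le1] := ltP w (v * 2).+1%:R.
  rewrite (@floor_def _ _ (v * 2)%N%:Z).
    by rewrite absz_nat oddM andbF addn0 le.
  by rewrite le -PoszD addn1.
rewrite (@floor_def _ _ (v * 2).+1%:Z).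
  by rewrite absz_nat /= oddM andbF addn1 le1.
by rewrite le1 -PoszD addn1.
Qed.

(** [CComp f U] halts only on programs of [U], hence is prefix-free and is simulated by [V]:
    applying a fixed code raises complexity by O(1) only. *)
Lemma optimal_postcompose V U f : optimal V -> prefix_free_machine U ->
  exists d, forall p w s, runs U p w -> eval f (enc w) (enc s) ->
    exists2 q, runs V q s & (size q <= size p + d)%N.
Proof.
move=> [_ oV] pU.
have pC : prefix_free_machine (CComp f U).
  have UC p : Dom (CComp f U) p -> Dom U p.
    case=> s H; inversion H as [| | | | | |? ? ? z ? gz fy| | |]; subst.
    by exists (dec z); rewrite /runs decK.
  by move=> p q /UC hp /UC hq; exact: pU.
have [d hd] := oV _ pC; exists d => p w s rp fs.
by have [|q [rq sq]] := hd p s; [exact: eComp rp fs|exists q].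
Qed.

(** Makes the search for a string of given length a bounded one. *)
Lemma enc_lt s : (enc s < 2 ^ (size s).+1)%N.
Proof.
suff : (enc s + 2 <= 2 ^ (size s).+1)%N by lia.
by elim: s => //= b s; rewrite [(2 ^ (_).+2)%N]expnS; case: b; lia.
Qed.

(* From the first [n] bits of Theta one finds a stage [t] with
   [Theta - theta t < 2 * 2^-n]; a string of length [n - 1] enumerated after
   that stage would add [2 * 2^-n], so all short strings of length [n - 1]
   are known at stage [t]. *)
Lemma Theta_random (R : realType) U V (T : R) D : optimal U -> optimal V ->
  0 < T -> T <= 1 -> enumerates V T D ->
  weakly_chaitin_random U T (fine (ThetaBar V T)).
Proof.
move=> [pU _] oV T0 T1 eD; have pV := proj1 oV; set Th := fine _.
have [rD ltD mD sD] := eD; have rt := rec_theta_num rD.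
(* The integer part of [Th], which [restr] discards, is a constant built into the algorithm. *)
pose F := `|Num.floor Th|%N.
have FE : (F%:R : R) = (Num.floor Th)%:~R.
  by rewrite /F natr_absz ger0_norm // floor_ge0; exact: Theta_ge0 pV T1 eD.
pose sz x := size (dec x); have rs : rec sz by apply: rec_size rec_id.
pose va x := vb (dec x); have rv : rec va by apply: rec_vb rec_id.
(* [theta t] exceeds, up to [2^-n], the number with integer part [F] and fractional bits [w], where
   [n] is the length of [w]; denominators are cleared. *)
pose P w t := ((F * 2 ^ sz w + va w) * 2 ^ t < theta_num D t * 2 ^ sz w + 2 ^ t)%N.
pose g w t := find (fun x => ((sz x).+1 == sz w) && ~~ D x t) (iota 0 (2 ^ sz w)).
have [f hf] : exists c, forall x y, eval c x y <-> exists n,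
    [/\ P x n, forall m, (m < n)%N -> ~~ P x m & y = g x n].
  by apply: eval_search; [rewrite /P|rewrite /g]; rec_tac.
have [d hd] := optimal_postcompose f oV pU.
(* [d] pays for the simulation, and 1 for passing from length [n] to [n - 1], as [T <= 1]. *)
exists d.+1 => n n0; apply/ereal_infP => _ [p rp <-]; rewrite lee_fin.
pose w := enc (restr Th n).
have szw : sz w = n by rewrite /sz encK size_restr.
have vaw : va w = vb (restr Th n) by rewrite /va encK.
have /andP[vle vlt] := vb_restr Th n.
have e0 m : (0 : R) < 2 ^+ m by rewrite exprn_gt0.
have PE t : P w t <-> F%:R + (va w)%:R / 2 ^+ n < theta R D t + 2 ^- n.
  rewrite -(ltr_pM2r (e0 n)) !mulrDl divfK ?mulVf ?gt_eqF //.
  rewrite -(ltr_pM2r (e0 t)) [X in _ < X]mulrDl mul1r mulrAC -theta_numE.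
  by rewrite -!natrX -!natrM -natrD -!natrM -natrD ltr_nat /P szw.
have FTh : F%:R + (va w)%:R / 2 ^+ n <= Th.
  by rewrite FE vaw -lerBrDl ler_pdivrMr // mulrC.
have ThF : Th < F%:R + (va w)%:R / 2 ^+ n + 2 ^- n.
  by rewrite -addrA -ltrBlDl FE vaw -{2}[2 ^- n]mul1r -mulrDl ltr_pdivlMr // mulrC natr1.
have exP : exists t, P w t.
  have [|t lt] := theta_approx pV T1 eD (x := Th - 2 ^- n); first by rewrite gtrBl invr_gt0.
  by exists t; apply/PE; apply: le_lt_trans FTh _; rewrite -ltrBlDr.
pose t := ex_minn exP.
have [Pt Pmin] : P w t /\ forall m, (m < t)%N -> ~~ P w m.
  rewrite /t; case: ex_minnP => k Pk kmin; split=> // m.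
  by apply: contraL => /kmin; rewrite -leqNgt.
have known s : (size s).+1 = n -> short V T s -> D (enc s) t.
  move=> ss shs; apply/negP => /negP nD; have /sD[u Du] : short V T (dec (enc s)) by rewrite encK.
  have Du' : D (enc s) (maxn t u) by apply: mD Du; exact: leq_maxr.
  have := theta_add eD (leq_maxl t u) Du' nD; apply/negP; rewrite -ltNge.
  apply: le_lt_trans (theta_le_Theta pV T1 eD _) _; apply: lt_le_trans ThF _.
  have E : (2 : R) ^- size s = 2 ^- n + 2 ^- n.
    by rewrite -ss exprS invfM; move: (2 ^- size s) => z; lra.
  rewrite E addrA lerD2r; exact/ltW/PE.
(* A string that is not short never enters a stage, so the bounded search in [g] succeeds. *)
have [s ss ns] := not_short (V := V) (T := T) n.-1 pV T1.
have has_s : has (fun x => ((sz x).+1 == sz w) && ~~ D x t) (iota 0 (2 ^ sz w)).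
  have sn : (size s).+1 = n by rewrite ss prednK.
  apply/hasP; exists (enc s); first by rewrite mem_iota /= szw -sn enc_lt.
  rewrite szw /sz encK sn eqxx /=; apply/negP => Ds; apply: ns.
  by rewrite -[s]encK; apply/sD; exists t.
pose s' := dec (g w t).
have [ss' Ds'] : (size s').+1 = n /\ ~~ D (enc s') t.
  have := nth_find 0%N has_s; rewrite nth_iota -?/(g w t) //; last first.
    by move: has_s; rewrite has_find size_iota.
  by rewrite add0n szw /s' decK => /andP[/eqP].
have [q rq sq] : exists2 q, runs V q s' & (size q <= size p + d)%N.
  by apply: hd rp _; apply/hf; exists t; rewrite /s' decK.
have : T * (size s')%:R <= (size q)%:R.
  rewrite leNgt; apply/negP => lt; move: Ds'; rewrite known //.
  by exists q.
move: sq; rewrite -(ler_nat R) natrD -ss' -[d.+1%:R]natr1 -[(size s').+1%:R]natr1.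
move: (size q)%:R (size p)%:R (size s')%:R (d%:R) => a b k l; nra.
Qed.

(** * Crossings of dyadic cells *)

Lemma sum_geometric_tail (R : realType) (r : R) m N : 0 < r -> r < 1 ->
  \sum_(n < N | (m <= n)%N) r ^+ n <= r ^+ m / (1 - r).
Proof.
move=> r0 r1; have p0 : 0 < 1 - r by rewrite subr_gt0.
(* Minus the tail of the series from [maxn n m] on; its increments are the summands. *)
pose g n := - (r ^+ maxn n m / (1 - r)).
have gS n : (if (m <= n)%N then r ^+ n else 0) = g n.+1 - g n.
  rewrite /g; case: leqP => h.
    rewrite !(maxn_idPl _) //; last exact: leqW.
    by rewrite opprK exprS; field; rewrite gt_eqF.
  by rewrite !(maxn_idPr _) ?subrr // ltnW.
rewrite big_mkcond -(big_mkord xpredT (fun n => if (m <= n)%N then r ^+ n else 0)).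
under eq_bigr do rewrite gS.
rewrite telescope_sumr // /g max0n opprK addrC gerDl oppr_le0.
by rewrite divr_ge0 ?exprn_ge0 ?ltW.
Qed.

Lemma sum_geometric_head (R : realType) (u : R) m N : 1 < u ->
  \sum_(n < N | (n < m)%N) u ^+ n <= u ^+ m / (u - 1).
Proof.
move=> u1; have p0 : 0 < u - 1 by rewrite subr_gt0.
have u0 : 0 < u by apply: lt_trans u1.
pose g n := u ^+ minn n m / (u - 1).
have gS n : (if (n < m)%N then u ^+ n else 0) = g n.+1 - g n.
  rewrite /g; case: ltnP => h.
    rewrite !(minn_idPl _) ?(ltnW h) //.
    by rewrite exprS; field; rewrite gt_eqF.
  by rewrite !(minn_idPr _) ?subrr // leqW.
rewrite big_mkcond -(big_mkord xpredT (fun n => if (n < m)%N then u ^+ n else 0)).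
under eq_bigr do rewrite gS.
rewrite telescope_sumr // /g min0n lerBlDr ler_wpDr //.
  by rewrite divr_ge0 ?expr0 // ltW.
by rewrite ler_pdivrMr // divfK ?gt_eqF // ler_eXn2l // geq_minr.
Qed.

(** The function [min(1, 2^(n - m))]: the share of the crossings at level [n] charged to a string of
    length [m]. *)
Definition cap (R : realType) n m : R := if (m <= n)%N then 1 else 2 ^+ n * 2 ^- m.

(** The part [n >= m] is geometric with ratio [r < 1], the part [n < m] with ratio [2 * r > 1]; both
    are dominated by the term near [n = m]. With [r = 2^(-T)] the bounds on [r] say [0 < T < 1]. *)
Lemma sum_cap (R : realType) (r : R) m N : 2^-1 < r -> r < 1 ->
  \sum_(n < N) r ^+ n * cap R n m <= ((1 - r)^-1 + (2 * r - 1)^-1) * r ^+ m.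
Proof.
move=> r12 r1; have r0 : 0 < r by apply: lt_trans r12; rewrite invr_gt0.
rewrite (bigID (fun n : 'I_N => (m <= n)%N)) /= mulrDl lerD //.
  rewrite (eq_bigr (fun n : 'I_N => r ^+ n)) => [|n le]; last by rewrite /cap le mulr1.
  by rewrite mulrC sum_geometric_tail.
rewrite (eq_bigr (fun n : 'I_N => (2 * r) ^+ n * 2 ^- m)) => [|n /negbTE le]; last first.
  by rewrite /cap le mulrA exprMn (mulrC (r ^+ n)).
under eq_bigl do rewrite -ltnNge.
have u1 : 1 < 2 * r by rewrite -ltr_pdivrMl // mulr1.
have -> : (2 * r - 1)^-1 * r ^+ m = (2 * r) ^+ m / (2 * r - 1) * 2 ^- m.
  by rewrite exprMn mulrC mulrAC (mulrC (2 ^+ m)) mulfK // expf_neq0 ?pnatr_eq0.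
by rewrite -mulr_suml ler_wpM2r ?sum_geometric_head // invr_ge0 exprn_ge0.
Qed.

Lemma unpair_le z : ((unpair z).1 <= z)%N /\ ((unpair z).2 <= z)%N.
Proof.
elim: z => //= z; case: (unpair z) => [[|x] y] /= [h1 h2]; lia.
Qed.

(** [unpair] maps the indices below [I] injectively into the square of side [I]. *)
Lemma sum_unpair (R : realType) (G : nat -> nat -> R) I : (forall x y, 0 <= G x y) ->
  \sum_(i < I) G (unpair i).1 (unpair i).2 <= \sum_(x < I) \sum_(y < I) G x y.
Proof.
move=> G0; rewrite -(big_mkord xpredT (fun i => G (unpair i).1 (unpair i).2)).
under [leRHS]eq_bigr do rewrite -(big_mkord xpredT (G _)).
rewrite -(big_mkord xpredT (fun x => \sum_(0 <= y < I) G x y)) /index_iota subn0.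
rewrite -(big_allpairs_dep (h := fun x y : nat => (x, y)) (r2 := fun _ => iota 0 I)
  (F := fun xy => G xy.1 xy.2)).
rewrite -(big_map unpair xpredT (fun xy => G xy.1 xy.2)).
apply: ler_sum_subset => //.
- rewrite map_inj_uniq ?iota_uniq // => x y E.
  by rewrite -[x]unpairK E unpairK.
- by apply: allpairs_uniq; rewrite ?iota_uniq // => -[? ?] [? ?] _ _ /= [-> ->].
move=> _ /mapP[i + ->]; rewrite mem_iota add0n /= => lt.
have [h1 h2] := unpair_le i; apply/allpairsP; exists (unpair i).
by rewrite !mem_iota add0n /= !(leq_ltn_trans _ lt) //; case: unpair.
Qed.

Definition level (D : nat -> nat -> bool) n t := ((theta_num D t * 2 ^ n) %/ 2 ^ t)%N.

Lemma level_itv (R : realType) D n t :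
  (level D n t)%:R <= theta R D t * 2 ^+ n < (level D n t).+1%:R.
Proof.
have t0 : (0 : R) < 2 ^+ t by rewrite exprn_gt0.
rewrite -(ler_pM2r t0) -(ltr_pM2r t0) mulrAC -theta_numE -!natrX -!natrM ler_nat ltr_nat.
by rewrite leq_trunc_div ltn_ceil // expn_gt0.
Qed.

Lemma nat_itv_inj (R : realType) (x : R) m n :
  m%:R <= x < m.+1%:R -> n%:R <= x < n.+1%:R -> m = n.
Proof.
by move=> /truncn_def <- /truncn_def.
Qed.

(** Stage 0 counts as a crossing so that the initial cell is requested as well. *)
Definition crossing D n k := (k == 0)%N || (level D n k != level D n k.-1).

(* Strings of length at most [n] move [theta] by multiples of [2^-n] and hence do
   not change its position inside a dyadic cell of length [2^-n]: a crossing is due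
   either to such a string or to the longer strings filling one more cell. *)
Lemma crossings_le (R : realType) V (T : R) D n K : enumerates V T D ->
  (\sum_(k < K) crossing D n k)%:R <= 1 + \sum_(s <- stage D K) cap R n (size s).
Proof.
move=> eD; pose L k := [seq s <- stage D k | (size s <= n)%N].
pose A k := (\sum_(s <- L k) 2 ^ (n - size s))%N.
pose B k : R := \sum_(s <- [seq s <- stage D k | (n < size s)%N]) 2 ^+ n * 2 ^- size s.
have f0 m : (0 : R) <= 2 ^+ n * 2 ^- m by rewrite mulr_ge0 ?exprn_ge0.
have B0 k : 0 <= B k by apply: sumr_ge0.
have AB k : theta R D k * 2 ^+ n = (A k)%:R + B k.
  rewrite theta_stage mulr_suml (bigID (fun s => (size s <= n)%N)) /= /A /B natr_sum !big_filter.
  congr (_ + _); last by apply: eq_big => s; rewrite ?ltnNge // mulrC.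
  by apply: eq_bigr => s le; rewrite exp2V_nat // mulrC.
(* [A k], due to strings of length at most [n], is an integer, so only [B k] is rounded. *)
have lE k : level D n k = (A k + Num.truncn (B k))%N.
  apply: nat_itv_inj (level_itv R D n k) _; rewrite AB.
  have /andP[h1 h2] := truncn_itv (B0 k).
  by rewrite -addnS !natrD lerD2l ltrD2l h1 h2.
(* [g] is nondecreasing and grows at every crossing: if both summands stay the same, so do [L] and
   [A], hence the level. *)
pose g k := (size (L k) + Num.truncn (B k))%N.
have Lsub k : {subset L k <= L k.+1}.
  by move=> s; rewrite !mem_filter => /andP[->]; exact/(stage_sub eD (leqnSn k)).
have uL k : uniq (L k) by rewrite filter_uniq // stage_uniq.
have gS k : (g k + crossing D n k.+1 <= g k.+1)%N.
  have le1 : (size (L k) <= size (L k.+1))%N by apply: uniq_leq_size.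
  have le2 : (Num.truncn (B k) <= Num.truncn (B k.+1))%N.
    apply: le_truncn; apply: ler_sum_subset => //; rewrite ?filter_uniq ?stage_uniq //.
    by move=> s; rewrite !mem_filter => /andP[->]; exact/(stage_sub eD (leqnSn k)).
  rewrite /crossing /=; case: eqP => /= [_|ne]; first by rewrite addn0 leq_add.
  rewrite addn1 ltn_neqAle leq_add // andbT; apply/eqP => E.
  have [E1 E2] : size (L k) = size (L k.+1) /\ Num.truncn (B k) = Num.truncn (B k.+1).
    by move: E; rewrite /g; lia.
  apply: ne; rewrite !lE E2; congr (_ + _)%N; rewrite /A; apply: perm_big.
  rewrite perm_sym; apply: uniq_perm (uL k) (uL k.+1) _.
  by case: (uniq_min_size (uL k) (@Lsub k)); rewrite ?E1.
have le_g k : (\sum_(i < k.+1) crossing D n i <= 1 + g k)%N.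
  elim: k => [|k IHk]; first by rewrite big_ord1.
  by rewrite big_ord_recr /= (leq_trans (leq_add IHk (leqnn _))) // -addnA leq_add2l gS.
apply: (@le_trans _ _ (1 + g K)%:R).
  by rewrite ler_nat (leq_trans _ (le_g K)) // big_ord_recr leq_addr.
rewrite natrD lerD2l /g natrD (bigID (fun s => (size s <= n)%N)) /= lerD //.
  rewrite -big_filter (eq_big_seq (fun=> 1)) => [|s]; last first.
    by rewrite mem_filter /cap => /andP[->].
  by rewrite big_const_seq count_predT iter_addr_0.
have : (Num.truncn (B K))%:R <= B K by rewrite truncn_le.
move/le_trans; apply; rewrite /B big_filter.
rewrite [leRHS](eq_bigl (fun s => (n < size s)%N)) => [|s]; last by rewrite ltnNge.
by apply: ler_sum => s; rewrite /cap ltnNge => /negbTE->.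
Qed.

(** * Compressibility of the sum *)

Lemma powR2_exp (R : realType) (T : R) n : (2 `^ (- T)) ^+ n = 2 `^ (- (T * n%:R)).
Proof. by rewrite -powR_mulrn ?powR_ge0 // -powRrM mulNr. Qed.

Lemma exp2V_powR (R : realType) n : (2 : R) ^- n = 2 `^ (- n%:R).
Proof. by rewrite powRN powR_mulrn. Qed.

Lemma powR2_gt1 (R : realType) (t : R) : 0 < t -> 1 < 2 `^ t.
Proof. by move=> t0; rewrite /powR gt_eqF // expR_gt1 mulr_gt0 // ln_gt0 // ltr1n. Qed.

(** Shortness bounds [2^(-T|s|)] by the weight of a program for [s]. *)
Lemma short_weight_le1 (R : realType) V (T : R) (A : seq bitseq) :
  prefix_free_machine V -> uniq A -> {in A, forall s, short V T s} ->
  \sum_(s <- A) (2 `^ (- T)) ^+ size s <= 1.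
Proof.
move=> pV uA sA; have [f hf] := short_programs V T.
have fA : {in A, forall s, runs V (f s) s} by move=> s /sA /hf[].
apply: le_trans (kraft_machine R pV uA fA); rewrite !big_seq; apply: ler_sum => s /sA /hf[_ lt].
by rewrite powR2_exp exp2V_powR ler_powR ?ler1n // lerN2 ltW.
Qed.

(* The index [i] codes a stage [k], a level [n] and a choice [b] between the lower
   and the upper end of the cell of length [2^-(n+1)] containing [theta k]: the
   limit of [theta] may be the upper end of the last cell visited. *)
Definition req_stage i := (unpair i).1.
Definition req_level i := (unpair (unpair i).2).1.
Definition req_bit i := (unpair (unpair i).2).2.
Definition request D i := (req_bit i < 2)%N && crossing D (req_level i).+1 (req_stage i).

(** After exchanging the sums, [sum_cap] charges each string [K * r ^+ size s] over all levels, and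
    [short_weight_le1] adds up the charges. *)
Lemma requests_sum (R : realType) V (T : R) D l : prefix_free_machine V ->
  0 < T -> T < 1 -> enumerates V T D -> (forall n, T * n.+1%:R <= (l n)%:R) ->
  exists c, forall I, \sum_(i < I | request D i) (2 : R) ^- (l (req_level i) + c) <= 1.
Proof.
move=> pV T0 T1 eD lT; pose r : R := 2 `^ (- T).
have r1 : r < 1 by rewrite /r powRN invf_lt1 ?powR_gt0 // powR2_gt1.
have r12 : 2^-1 < r.
  have -> : r = 2^-1 * 2 `^ (1 - T).
    by rewrite powRD ?pnatr_eq0 ?implybT // powRr1 // mulrA mulVf ?mul1r // pnatr_eq0.
  by rewrite ltr_pMr ?invr_gt0 // powR2_gt1 // subr_gt0.
have r0 : 0 < r by apply: lt_trans r12; rewrite invr_gt0.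
pose K := (1 - r)^-1 + (2 * r - 1)^-1.
(* In [4 * K] one factor 2 comes from the two values of the bit, the other from the extra 1 in
   [crossings_le] beside the sum over strings. *)
pose c := Num.bound (4 * K).
have K0 : 0 <= K by rewrite addr_ge0 // invr_ge0; move: r12; lra.
have cK : 4 * K * 2 ^- c <= 1.
  rewrite ler_pdivrMr ?exprn_gt0 // mul1r ltW // (lt_trans (archi_boundP _)) ?mulr_ge0 //.
  by rewrite -natrX ltr_nat ltn_expl.
exists c => I.
have capsum m : \sum_(n < I) r ^+ n.+1 * cap R n.+1 m <= K * r ^+ m.
  apply: le_trans (sum_cap m I.+1 r12 r1); rewrite big_ord_recl lerDr.
  by rewrite /cap; case: ifP => _; rewrite !mulr_ge0 ?invr_ge0 ?exprn_ge0 // ltW.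
pose G k n b : R := if (b < 2)%N && crossing D n.+1 k then 2 ^- (l n + c) else 0.
have G0 k n b : 0 <= G k n b by rewrite /G; case: ifP.
rewrite big_mkcond.
apply: le_trans (sum_unpair I (G := fun k y => G k (unpair y).1 (unpair y).2) _) _ => //.
apply: (@le_trans _ _ (\sum_(k < I) \sum_(n < I) \sum_(b < I) G k n b)).
  by apply: ler_sum => k _; apply: sum_unpair.
have Gb k n : \sum_(b < I) G k n b <= (crossing D n.+1 k)%:R * (2 * 2 ^- (l n + c)).
  rewrite /G; case: crossing; last by rewrite mul0r big1 // => b _; rewrite andbF.
  under eq_bigr do rewrite andbT.
  rewrite mul1r mulrDl mul1r; have e0 := exp2V_ge0 R (l n + c).
  case: (I) => [|[|I']]; first by rewrite big_ord0 addr_ge0.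
    by rewrite big_ord1 lerDl.
  by rewrite 2!big_ord_recl big1 ?addr0.
apply: (@le_trans _ _ (\sum_(k < I) \sum_(n < I) (crossing D n.+1 k)%:R * (2 * 2 ^- (l n + c)))).
  by apply: ler_sum => k _; apply: ler_sum => n _; exact: Gb.
rewrite exchange_big /=.
pose S := stage D I.
apply: (@le_trans _ _ (\sum_(n < I) (2 * 2 ^- c) *
   (r ^+ n.+1 * cap R n.+1 0 + \sum_(s <- S) r ^+ n.+1 * cap R n.+1 (size s)))).
  apply: ler_sum => n _; rewrite -mulr_suml -natr_sum.
  apply: (@le_trans _ _ ((1 + \sum_(s <- S) cap R n.+1 (size s)) * (2 * 2 ^- (l n + c)))).
    by rewrite ler_wpM2r ?mulr_ge0 // (crossings_le _ _ eD).
  (* The extra 1 is treated as the share of a string of length 0. *)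
  rewrite -mulr_sumr -mulrDr (_ : 1 + _ = cap R n.+1 0 + \sum_(s <- S) cap R n.+1 (size s)) //.
  set X := cap _ _ _ + _; have X0 : 0 <= X.
    rewrite /X; apply: addr_ge0 => //; apply: sumr_ge0 => s _; by rewrite /cap; case: ifP.
  have -> : X * (2 * 2 ^- (l n + c)) = 2 * 2 ^- c * (2 ^- l n * X) by rewrite exprD invfM; ring.
  rewrite ler_wpM2l ?mulr_ge0 // ler_wpM2r //.
  by rewrite powR2_exp exp2V_powR ler_powR ?ler1n // lerN2.
rewrite -mulr_sumr big_split /= exchange_big /=.
apply: le_trans cK; rewrite (_ : 4 * K * 2 ^- c = 2 * 2 ^- c * (K + K)); last by ring.
rewrite ler_wpM2l ?mulr_ge0 // lerD //.
  by have := capsum 0%N; rewrite expr0 mulr1.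
apply: (@le_trans _ _ (\sum_(s <- S) K * r ^+ size s)).
  by apply: ler_sum => s _; exact: capsum.
rewrite -mulr_sumr ler_piMr //; apply: short_weight_le1 pV _ _; first exact: stage_uniq.
exact: stage_short eD.
Qed.

(** Take the highest cell [v] ever visited and the first stage in it, which is a crossing. The limit
    [Th * 2^N] lies in the closed interval from [v] to [v + 1], so its floor is one of the two, as
    selected by the bit. Reduction modulo [2^N] removes the integer part. *)
Lemma request_exists (R : realType) V (T : R) D n : prefix_free_machine V -> T <= 1 ->
  enumerates V T D -> exists2 i, request D i & req_level i = n /\
    ((level D n.+1 (req_stage i) + req_bit i) %% 2 ^ n.+1 =
     vb (restr (fine (ThetaBar V T)) n.+1))%N.
Proof.
move=> pV T1 eD; set Th := fine _; set N := n.+1.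
have e0 m : (0 : R) < 2 ^+ m by rewrite exprn_gt0.
have level_le t : (level D N t <= 2 ^ N)%N.
  have /andP[h _] := level_itv R D N t; rewrite -(ler_nat R) natrX (le_trans h) // ger_pMl //.
  exact: le_trans (theta_le_Theta pV T1 eD t) (Theta_le1 pV T1).
have exv : exists v, `[< exists t, level D N t = v >].
  by exists (level D N 0); apply/asboolP; exists 0%N.
have vle v : `[< exists t, level D N t = v >] -> (v <= 2 ^ N)%N by move/asboolP => -[t <-].
case: (ex_maxnP exv vle) => v /asboolP ext vmax.
have ext' : exists t, level D N t == v by case: ext => t <-; exists t.
case: (ex_minnP ext') => k /eqP kv kmin.
have chg : crossing D N k.
  rewrite /crossing; case: k kv kmin => // k kv kmin; apply/eqP => E.
  by have := kmin k; rewrite -E kv eqxx ltnn => /(_ isT).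
have v_le : v%:R <= Th * 2 ^+ N.
  have /andP[h _] := level_itv R D N k; rewrite -kv (le_trans h) // ler_wpM2r ?(ltW (e0 _)) //.
  exact: theta_le_Theta pV T1 eD k.
have le_v : Th * 2 ^+ N <= v.+1%:R.
  rewrite -ler_pdivlMr // leNgt; apply/negP => /(theta_approx pV T1 eD)[t].
  rewrite ltr_pdivrMr // => lt; have /andP[_ h] := level_itv R D N t.
  have := lt_trans lt h; rewrite ltr_nat ltnS ltnNge vmax //.
  by apply/asboolP; exists t.
pose F := `|Num.floor Th|%N.
have FE : (Num.floor Th)%:~R = F%:R :> R.
  by rewrite /F natr_absz ger0_norm // floor_ge0; exact: Theta_ge0 pV T1 eD.
have := vb_restr Th N; rewrite FE mulrBr [_ * Th]mulrC -natrX -natrM lerBrDr ltrBlDr -!natrD.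
set w := vb _; rewrite [(2 ^ N)%:R]natrX => /andP[w1 w2].
have w_lt : (w < 2 ^ N)%N by have := vb_lt (restr Th N); rewrite size_restr.
have b1 : (v <= w + 2 ^ N * F)%N.
  by have := le_lt_trans v_le w2; rewrite ltr_nat addSn ltnS.
have b2 : (w + 2 ^ N * F <= v.+1)%N by have := le_trans w1 le_v; rewrite ler_nat.
pose b := (w + 2 ^ N * F - v)%N.
exists (npair k (npair n b)); rewrite /request /req_stage /req_level /req_bit !npairK /= ?npairK /=.
  by rewrite chg andbT /b; lia.
by split=> //; rewrite -/N kv /b subnKC // mulnC addnC modnMDl modn_small.
Qed.

Lemma Theta_compressible (R : realType) U V (T : R) D l : optimal U ->
  prefix_free_machine V -> 0 < T -> T < 1 -> enumerates V T D -> rec l ->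
  (forall n, T * n.+1%:R <= (l n)%:R <= T * n.+1%:R + 3) ->
  strictly_compressible U T (fine (ThetaBar V T)).
Proof.
move=> [_ oU] pV T0 T1 eD rl lT; have [rD _ _ _] := eD; have rt := rec_theta_num rD.
set Th := fine _.
have [c sumc] := requests_sum pV T0 T1 eD (fun n => proj1 (andP (lT n))).
pose sz x := size (dec x); have rs : rec sz by apply: rec_size rec_id.
pose va x := vb (dec x); have rv : rec va by apply: rec_vb rec_id.
pose val i := ((level D (req_level i).+1 (req_stage i) + req_bit i) %% 2 ^ (req_level i).+1)%N.
(* By [enc_lt] the range contains the codes of all strings of length [(req_level i).+1]. *)
pose out i := find (fun x => (sz x == (req_level i).+1) && (va x == val i))
  (iota 0 (2 ^ (req_level i).+2)).
have rlev : rec2 (level D) by rewrite /level; rec_tac.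
have rval : rec val by rewrite /val /req_level /req_stage /req_bit; rec_tac.
have rout : rec out by rewrite /out /req_level; rec_tac.
have rlen : rec (fun i => l (req_level i) + c)%N by rewrite /req_level; rec_tac.
have rcross : recb (fun i => crossing D (req_level i).+1 (req_stage i)).
  (* The disjunction in [crossing] is expressed by negation and conjunction. *)
  have : rec (fun i => ~~ (~~ (req_stage i == 0%N) &&
      (level D (req_level i).+1 (req_stage i) == level D (req_level i).+1 (req_stage i).-1))).
    by rewrite /req_level /req_stage; rec_tac.
  by apply: rec_eq => i; rewrite negb_and negbK.
have rreq : recb (request D).
  by rewrite /request; apply: rec_and rcross; rewrite /req_bit; rec_tac.
have [C pC CP] := kraft_chaitin rlen rout rreq sumc.
have [d dP] := oU C pC.
(* [c] normalizes the Kraft sum, [d] comes from optimality of [U], 3 from rounding [T * n] up, and 1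
   from [kraft_chaitin]. *)
exists (c + d + 4)%N => n n0; rewrite -(prednK n0).
have [i ri [ni vi]] := request_exists n.-1 pV (ltW T1) eD.
have [p sp rp] := CP i ri.
have outE : out i = enc (restr Th n.-1.+1).
  have ha : has (fun x => (sz x == (req_level i).+1) && (va x == val i))
      (iota 0 (2 ^ (req_level i).+2)).
    apply/hasP; exists (enc (restr Th n.-1.+1)).
      by rewrite mem_iota ni; have := enc_lt (restr Th n.-1.+1); rewrite size_restr.
    by rewrite /sz /va encK size_restr ni eqxx /val ni vi eqxx.
  have := nth_find 0%N ha; rewrite nth_iota ?add0n -/(out i); last first.
    by move: ha; rewrite has_find size_iota.
  move=> /andP[/eqP s1 /eqP v1]; rewrite -[out i]decK; congr enc.
  apply: vb_inj; first by rewrite size_restr -ni.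
  by rewrite -/(va _) v1 /val ni vi.
have [|q [rq sq]] := dP p (restr Th n.-1.+1); first by rewrite /runs -outE.
apply: le_trans (ereal_inf_lbound _) _; first by exists q; [exact: rq|reflexivity].
rewrite lee_fin; apply: (@le_trans _ _ (l n.-1 + c + 1 + d)%:R).
  by rewrite ler_nat (leq_trans sq) // sp ni addn1.
have /andP[_ h] := lT n.-1; rewrite !natrD; move: h.
by move: (T * _) => y; lra.
Qed.

Unset Implicit Arguments.

Theorem theorem8 (R : realType) (U V : mrcode) (T : R) :
  optimal U -> optimal V -> 0 < T ->
  [/\ (left_computable T -> T <= 1 ->
         ThetaBar V T \is a fin_num /\
         left_computable (fine (ThetaBar V T)) /\
         weakly_chaitin_random U T (fine (ThetaBar V T))),
      (computable_real T -> T < 1 ->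
         ThetaBar V T \is a fin_num /\
         strictly_compressible U T (fine (ThetaBar V T)))
    & (1 < T -> ThetaBar V T = +oo%E)].
Proof.
move=> oU oV T0; have pV := proj1 oV; split.
- move=> /(left_lower_approx T0)[a [b /(short_enumerable V)[D eD]]] T1.
  split; first exact: ThetaBar_fin.
  split; first exact: Theta_left_computable eD.
  exact: Theta_random eD.
- move=> cT T1; have [a [b /(short_enumerable V)[D eD]]] := computable_lower_approx T0 cT.
  have [l rl lT] := computable_ceil T0 cT.
  split; first exact/ThetaBar_fin/ltW.
  exact: Theta_compressible eD rl lT.
- exact: ThetaBar_gt1.
Qed.
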